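(* Consider the saddle-point problem $$\min_{x\in\mathbb{R}^n}\max_{y\in\mathbb{R}^m}\{r(x)+\langle Ax,y\rangle-h(y)\},$$ where $A:\mathbb{R}^n\to\mathbb{R}^m$ is a (nonzero) linear operator, $r:\mathbb{R}^n\to\mathbb{R}$ is $\mu_x$-strongly convex with $L_x$-Lipschitz gradient, and $h:\mathbb{R}^m\to\mathbb{R}$ is $\mu_y$-strongly convex with $L_y$-Lipschitz gradient ($\mu_x,\mu_y>0$) and is prox-friendly. Then an $\varepsilon$-solution can be reached with $\tilde O\left(\sqrt{L_x/\mu_x}\right)$ computations of $\nabla r(x)$ and with a number of computations of $\nabla_xF(x,y)=A^Ty$, of $\nabla_yF(x,y)=Ax$, and of the proximal problem for $h$ bounded by $$[\text{number of computations of }\nabla r(x)]\cdot\tilde O\left(\sqrt{\frac{L_y\lambda_{\max}(A^TA)}{\mu_y\lambda_{\min}^+(A^TA)}}\right)=\tilde O\left(\sqrt{\frac{L_xL_y\,\lambda_{\max}(A^TA)}{\mu_x\mu_y\,\lambda_{\min}^+(A^TA)}}\right),$$ where $\lambda_{\min}^+(A^TA)$ is the smallest positive eigenvalue of $A^TA$ and $\lambda_{\max}(A^TA)$ its largest eigenvalue.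
   Context: $\langle\cdot,\cdot\rangle$ is the standard scalar product, $\|\cdot\|_2$ the Euclidean norm; $F(x,y)=\langle Ax,y\rangle$, $Q_x=\mathbb{R}^n$, $Q_y=\mathbb{R}^m$. $h$ is prox-friendly if every problem $\min_{y\in Q_y}\{\langle c_1,y\rangle+h(y)+c_2\|y\|_2^2\}$ with a vector $c_1$ and $c_2>0$ can be solved explicitly (this is ''the proximal problem for $h$''; solving one such problem is one computation). Let $f(x)=r(x)+\max_{y\in Q_y}\{F(x,y)-h(y)\}$, let $x_*$ be the minimizer of $f$ on $Q_x$, and $y^*(x)=\arg\max_{y\in Q_y}\{F(x,y)-h(y)\}$. Let $(x^0,y^0)\in Q_x\times Q_y$ be the starting point of the method, $R_x=\|x^0-x_*\|_2$, $R_y=\|y^0-y^*(x_* )\|_2$. An $\varepsilon$-solution is a pair $(\hat x,\hat y)\in Q_x\times Q_y$ such that $$f(\hat x)-f(x_* )\le\max_{y\in Q_y\cap B_m(2R_y)}\{r(\hat x)+F(\hat x,y)-h(y)\}-\min_{x\in Q_x\cap B_n(2R_x)}\{r(x)+F(x,\hat y)-h(\hat y)\}\le\varepsilon,$$ where $B_n(2R_x)\subset\mathbb{R}^n$ and $B_m(2R_y)\subset\mathbb{R}^m$ are Euclidean balls of radii $2R_x$, $2R_y$ (centred at $x^0$ and $y^0$ respectively). ''Can be reached with ... computations'' means that there is an iterative method that, for every such problem and every $\varepsilon>0$, outputs an $\varepsilon$-solution and makes at most the indicated numbers of calls to the indicated oracles; only these calls are counted. $\tilde O(\cdot)$ means $O(\cdot)$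 up to a small power (as a rule 1 or 2) of a factor that is logarithmic in $\varepsilon$, $\mu_x$ or $\mu_y$, and in $R_x$ or $R_y$.
   Formalization: The factor hidden in Õ is also logarithmic in L_x, L_y, λ_max and λ_min^+ (its square is used); with logarithms of only ε, μ, R the bound fails, e.g. for bounded condition numbers and λ_max→∞. *)

(* Defs.v *)
From HB Require Import structures.
From mathcomp Require Export all_boot all_order all_algebra.
From mathcomp Require Export all_classical all_reals all_analysis.

Set Implicit Arguments.
Unset Strict Implicit.
Unset Printing Implicit Defensive.

Import Order.TTheory GRing.Theory Num.Theory.
Import numFieldNormedType.Exports.

Local Open Scope classical_set_scope.
Local Open Scope ring_scope.

Section Euclid.
Context {R : realType}.

Definition dot {n : nat} (u v : 'cV[R]_n) : R := \sum_i u i 0 * v i 0.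

(* The canonical norm `|u| on matrices is the sup norm, hence this one. *)
Definition norm2 {n : nat} (u : 'cV[R]_n) : R := Num.sqrt (dot u u).

Definition ball2 {n : nat} (c : 'cV[R]_n) (rho : R) : set 'cV[R]_n :=
  [set u | norm2 (u - c) <= rho].

Definition grad {n : nat} (f : 'cV[R]_n -> R) (x : 'cV[R]_n) : 'cV[R]_n :=
  \col_i 'D_(delta_mx i 0) (f : 'cV[R]_n -> R^o) x.

Definition strongly_convex {n : nat} (mu : R) (f : 'cV[R]_n -> R) : Prop :=
  forall (u v : 'cV[R]_n) (t : R), 0 <= t <= 1 ->
    f (t *: u + (1 - t) *: v) <=
      t * f u + (1 - t) * f v - mu / 2 * t * (1 - t) * norm2 (u - v) ^+ 2.

Definition lipschitz_gradient {n : nat} (L : R) (f : 'cV[R]_n -> R) : Prop :=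
  (forall u, differentiable (f : 'cV[R]_n -> R^o) u) /\
  (forall u v, norm2 (grad f u - grad f v) <= L * norm2 (u - v)).

Definition minimizer {T : Type} (f : T -> R) (a : T) : Prop :=
  forall b, f a <= f b.

Definition maximizer {T : Type} (f : T -> R) (a : T) : Prop :=
  forall b, f b <= f a.

Definition largest_eigenvalue {n : nat} (S : 'M[R]_n) (l : R) : Prop :=
  eigenvalue S l /\ forall a, eigenvalue S a -> a <= l.

Definition smallest_positive_eigenvalue {n : nat} (S : 'M[R]_n) (l : R) : Prop :=
  [/\ eigenvalue S l, 0 < l & forall a, eigenvalue S a -> 0 < a -> l <= a].

End Euclid.

Section SaddleProblem.
Context {R : realType} {n m : nat}.

Record saddle_problem := SaddleProblem {
  pr : 'cV[R]_n -> R;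
  ph : 'cV[R]_m -> R;
  pA : 'M[R]_(m, n)
}.

Variable p : saddle_problem.

Definition saddle (x : 'cV[R]_n) (y : 'cV[R]_m) : R :=
  pr p x + dot (pA p *m x) y - ph p y.

(* For strongly convex [ph p] the supremum is attained; likewise for the
   extrema over balls in [eps_solution]. *)
Definition primal (x : 'cV[R]_n) : R :=
  pr p x + sup [set dot (pA p *m x) y - ph p y | y in [set: 'cV[R]_m]].

Definition best_response (x : 'cV[R]_n) (y : 'cV[R]_m) : Prop :=
  maximizer (fun y' => dot (pA p *m x) y' - ph p y') y.

Definition eps_solution (eps : R) (x0 : 'cV[R]_n) (y0 : 'cV[R]_m) (Rx Ry : R)
    (xs xh : 'cV[R]_n) (yh : 'cV[R]_m) : Prop :=
  let gap := sup [set saddle xh y | y in ball2 y0 (2 * Ry)]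
           - inf [set saddle x yh | x in ball2 x0 (2 * Rx)] in
  primal xh - primal xs <= gap /\ gap <= eps.

Definition prox_solver (h : 'cV[R]_m -> R)
    (prox : 'cV[R]_m -> {posnum R} -> 'cV[R]_m) : Prop :=
  forall (c1 : 'cV[R]_m) (c2 : {posnum R}),
    minimizer (fun y => dot c1 y + h y + c2%:num * norm2 y ^+ 2) (prox c1 c2).

End SaddleProblem.

Arguments saddle_problem R n m : clear implicits.

Section Methods.
Context {R : realType} {n m : nat}.

(* A deterministic adaptive method: a well-founded tree, so that every run stops.
   The problem is accessible to it only through the oracle answers. *)
Inductive method : Type :=
| Return of 'cV[R]_n & 'cV[R]_m
| CallGrad of 'cV[R]_n & ('cV[R]_n -> method)
| CallAT of 'cV[R]_m & ('cV[R]_n -> method)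
| CallA of 'cV[R]_n & ('cV[R]_m -> method)
| CallProx of 'cV[R]_m & {posnum R} & ('cV[R]_m -> method).

Record outcome := Outcome {
  out_x : 'cV[R]_n;
  out_y : 'cV[R]_m;
  num_grad : nat;
  num_AT : nat;
  num_A : nat;
  num_prox : nat
}.

Fixpoint run (p : saddle_problem R n m)
    (prox : 'cV[R]_m -> {posnum R} -> 'cV[R]_m) (M : method) : outcome :=
  match M with
  | Return x y => Outcome x y 0 0 0 0
  | CallGrad x k =>
      let: Outcome xh yh g at_ a q := run p prox (k (grad (pr p) x)) in
      Outcome xh yh g.+1 at_ a q
  | CallAT y k =>
      let: Outcome xh yh g at_ a q := run p prox (k ((pA p)^T *m y)) in
      Outcome xh yh g at_.+1 a q
  | CallA x k =>
      let: Outcome xh yh g at_ a q := run p prox (k (pA p *m x)) in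
      Outcome xh yh g at_ a.+1 q
  | CallProx c1 c2 k =>
      let: Outcome xh yh g at_ a q := run p prox (k (prox c1 c2)) in
      Outcome xh yh g at_ a q.+1
  end.

End Methods.

Arguments method R n m : clear implicits.

Record constants (R : realType) := Constants {
  mux : R;
  Lx : R;
  muy : R;
  Ly : R;
  lmax : R;
  lmin : R
}.

Section Class.
Context {R : realType} {n m : nat}.

Record in_class (c : constants R) (p : saddle_problem R n m) : Prop := InClass {
  class_mux : 0 < mux c;
  class_muy : 0 < muy c;
  class_A : pA p != 0;
  class_r_convex : strongly_convex (mux c) (pr p);
  class_r_smooth : lipschitz_gradient (Lx c) (pr p);
  class_h_convex : strongly_convex (muy c) (ph p);
  class_h_smooth : lipschitz_gradient (Ly c) (ph p);
  class_lmax : largest_eigenvalue ((pA p)^T *m pA p) (lmax c);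
  class_lmin : smallest_positive_eigenvalue ((pA p)^T *m pA p) (lmin c)
}.

End Class.

(* The logarithmic factor hidden in the O-tilde. The logarithms of [Lx], [Ly],
   [lmax] and [lmin] cannot all be dropped: for mux = muy = eps = 1, Rx, Ry <= 1
   and bounded condition numbers, already approximating a solution of Ax = b
   to relative accuracy lmax^(-1/2) takes of the order of ln lmax products
   with A. *)
Definition log_factor {R : realType} (c : constants R) (eps Rx Ry : R) : R :=
  1 + `|ln eps| + `|ln (mux c)| + `|ln (muy c)| + ln (1 + Rx) + ln (1 + Ry)
    + `|ln (Lx c)| + `|ln (Ly c)| + `|ln (lmax c)| + `|ln (lmin c)|.

(* The small power of the logarithmic factor is taken to be 2; as [log_factor]
   is at least 1, this covers the power 1 as well. *)
Definition Otilde {R : realType} (C : R) (c : constants R) (eps Rx Ry : R)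
    (B : R) (N : nat) : Prop :=
  N%:R <= C * B * log_factor c eps Rx Ry ^+ 2.

(* Main.v *)
Require Import Defs.
From mathcomp Require Import ring lra.
Import Order.TTheory GRing.Theory Num.Theory.
Import numFieldNormedType.Exports.
Set Implicit Arguments.
Unset Strict Implicit.
Unset Printing Implicit Defensive.
Local Open Scope classical_set_scope.
Local Open Scope ring_scope.

(** Write [f = r + g] with [g x = max_y (<Ax, y> - h y)]. An accelerated proximal
gradient method on [f] calls the gradient of [r] about [sqrt (Lx / mux)] times, up to
logarithms; each step needs the proximal map of [g], the minimizer of
[M/2 |d|^2 + g (w + d)] over [d]. That minimizer lies in the range of [A^T], where
[g] is [lmin / (4 Ly)]-strongly convex, while [g] is [(lmax / muy)]-smooth everywhere:
accelerated gradient descent started at [d = 0] never leaves this range, hence solves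
the inner problem in [sqrt kA] steps up to logarithms. The gradient [A^T y(x)] of [g]
would need an exact maximizer, so [h] is replaced by [h + c2 |. - y0|^2] with a
tiny [c2], which makes [y(x)] one proximal problem and does not affect the rates.

The distances [Rx], [Ry] are unknown to the method. The residual at [x0] bounds them
through strong monotonicity; the bound is polynomial in [Rx], [Ry] and the constants,
so that its logarithm is of the order of [log_factor]. All accuracies are powers of a
number [E] dominating the bound, the constants and their inverses; the exponents are
far from optimal.

No minimizer of a regularized or inner problem is ever considered: the potential
argument for accelerated methods works for an arbitrary reference point. *)

(** * Euclidean geometry *)

Section Dot.
Context {R : realType}.

Section Vectors.
Context {n : nat}.
Implicit Types (u v w : 'cV[R]_n) (a : R).

Lemma dotC u v : dot u v = dot v u.
Proof. by apply: eq_bigr => i _; rewrite mulrC. Qed.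

Lemma dotDl u v w : dot (u + v) w = dot u w + dot v w.
Proof. by rewrite -big_split; apply: eq_bigr => i _; rewrite !mxE mulrDl. Qed.

Lemma dotZl a u w : dot (a *: u) w = a * dot u w.
Proof. by rewrite mulr_sumr; apply: eq_bigr => i _; rewrite !mxE mulrA. Qed.

Lemma dotNl u w : dot (- u) w = - dot u w.
Proof. by rewrite -scaleN1r dotZl mulN1r. Qed.

Lemma dotDr u v w : dot w (u + v) = dot w u + dot w v.
Proof. by rewrite dotC dotDl !(dotC _ w). Qed.

Lemma dotZr a u w : dot w (a *: u) = a * dot w u.
Proof. by rewrite dotC dotZl dotC. Qed.

Lemma dotNr u w : dot w (- u) = - dot w u.
Proof. by rewrite dotC dotNl dotC. Qed.

Lemma dot0l w : dot 0 w = 0.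
Proof. by rewrite -(scale0r 0) dotZl mul0r. Qed.

Lemma dot0r w : dot w 0 = 0.
Proof. by rewrite dotC dot0l. Qed.

Lemma dotvv_ge0 u : 0 <= dot u u.
Proof. by apply: sumr_ge0 => i _; rewrite -expr2 sqr_ge0. Qed.

Lemma dotvv_eq0 u : (dot u u == 0) = (u == 0).
Proof.
apply/idP/eqP => [|->]; last by rewrite dot0l.
rewrite psumr_eq0 => [/allP u0|i _]; last by rewrite -expr2 sqr_ge0.
apply/colP => i; rewrite mxE; apply/eqP.
by have := u0 i (mem_index_enum _); rewrite mulf_eq0 orbb.
Qed.

Definition dotE := (dotDl, dotDr, dotNl, dotNr, dotZl, dotZr).

Lemma dot_young a u v : 0 < a ->
  dot u v <= a / 2 * dot u u + (2 * a)^-1 * dot v v.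
Proof.
move=> a0; rewrite -subr_ge0.
have -> : a / 2 * dot u u + (2 * a)^-1 * dot v v - dot u v =
    (2 * a)^-1 * dot (a *: u - v) (a *: u - v).
  by rewrite !dotE (dotC v u); field; rewrite gt_eqF.
by rewrite mulr_ge0 ?dotvv_ge0// invr_ge0 mulr_ge0// ltW.
Qed.

Lemma norm2_ge0 u : 0 <= norm2 u.
Proof. exact: sqrtr_ge0. Qed.

Lemma norm2_sqr u : norm2 u ^+ 2 = dot u u.
Proof. by rewrite sqr_sqrtr// dotvv_ge0. Qed.

Lemma norm2_eq0 u : (norm2 u == 0) = (u == 0).
Proof. by rewrite -sqrf_eq0 norm2_sqr dotvv_eq0. Qed.

Lemma norm2N u : norm2 (- u) = norm2 u.
Proof. by rewrite /norm2 dotNl dotNr opprK. Qed.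

Lemma norm2_distC u v : norm2 (u - v) = norm2 (v - u).
Proof. by rewrite -norm2N opprB. Qed.

Lemma dot_norm2_le u v : dot u v <= norm2 u * norm2 v.
Proof.
have [->|u0] := eqVneq u 0; first by rewrite dot0l mulr_ge0 ?norm2_ge0.
have [->|v0] := eqVneq v 0; first by rewrite dot0r mulr_ge0 ?norm2_ge0.
have hu : 0 < norm2 u by rewrite lt0r norm2_eq0 u0 norm2_ge0.
have hv : 0 < norm2 v by rewrite lt0r norm2_eq0 v0 norm2_ge0.
(* The weight |v| / |u| turns Young's bound into exactly |u| |v|. *)
apply: le_trans (dot_young u v (divr_gt0 hv hu)) _.
by rewrite -!norm2_sqr; rewrite le_eqVlt; apply/orP; left; apply/eqP; field; rewrite !gt_eqF.
Qed.

Lemma norm2D u v : norm2 (u + v) <= norm2 u + norm2 v.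
Proof.
rewrite -(ler_pXn2r (ltn0Sn 1)) ?nnegrE ?addr_ge0 ?norm2_ge0//.
rewrite norm2_sqr !dotE sqrrD !norm2_sqr (dotC v u).
by have := dot_norm2_le u v; lra.
Qed.

Lemma norm2Z a u : norm2 (a *: u) = `|a| * norm2 u.
Proof. by rewrite /norm2 dotZl dotZr mulrA -expr2 sqrtrM ?sqr_ge0// sqrtr_sqr. Qed.

Lemma norm2_le_sqr u a : 0 <= a -> (norm2 u <= a) = (dot u u <= a ^+ 2).
Proof. by move=> a0; rewrite -norm2_sqr ler_pXn2r// nnegrE norm2_ge0. Qed.

Lemma dot_delta (i : 'I_n) u : dot u (delta_mx i 0) = u i 0.
Proof.
rewrite /dot (bigD1 i)//= mxE !eqxx mulr1 big1 ?addr0// => j ji.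
by rewrite mxE (negbTE ji) mulr0.
Qed.

End Vectors.

Lemma dot_mulmx {n m : nat} (A : 'M[R]_(m, n)) x y :
  dot (A *m x) y = dot x (A^T *m y).
Proof.
rewrite /dot; under eq_bigr do rewrite mxE mulr_suml.
rewrite exchange_big; apply: eq_bigr => j _; rewrite mxE mulr_sumr.
by apply: eq_bigr => i _; rewrite !mxE mulrA (mulrC (x j 0)).
Qed.

(** For small [t] of sign opposite to [a] the linear term wins; t = - a / (|b| + 1) is small
    enough. *)
Lemma linear_coef_eq0 (a b : R) : (forall t, 0 <= t * a + t ^+ 2 * b) -> a = 0.
Proof.
move=> h; apply/eqP/negPn/negP => a0.
pose d := `|b| + 1.
have d0 : 0 < d by rewrite /d ltr_wpDl.
have := h (- a / d).
have -> : - a / d * a + (- a / d) ^+ 2 * b = - (a ^+ 2 / d ^+ 2 * (d - b)).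
  by field; rewrite gt_eqF.
rewrite oppr_ge0; apply/negP; rewrite -ltNge mulr_gt0 ?divr_gt0//.
- by rewrite exprn_even_gt0.
- by rewrite exprn_gt0.
by rewrite subr_gt0 /d; have := ler_norm b; lra.
Qed.

(** Fermat's rule for functions known only through a quadratic upper model: at a minimizer the slope
    of the model vanishes, and the function itself is never differentiated. *)
Lemma first_order_eq0 {n : nat} (G : 'cV[R]_n) (K : R) :
  (forall d, 0 <= dot G d + K * dot d d) -> G = 0.
Proof.
move=> h; apply/eqP; rewrite -dotvv_eq0; apply/eqP.
apply: (@linear_coef_eq0 _ (K * dot G G)) => t.
by have := h (t *: G); rewrite !dotE; lra.
Qed.

End Dot.

(** * First-order inequalities *)

Section FirstOrder.
Context {R : realType} {n : nat}.
Implicit Types (u v : 'cV[R]_n) (f : 'cV[R]_n -> R).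

Lemma dot_grad f u v : differentiable (f : 'cV[R]_n -> R^o) u ->
  dot (grad f u) v = 'D_v (f : 'cV[R]_n -> R^o) u.
Proof.
move=> df; rewrite deriveE//.
have -> : v = \sum_i v i 0 *: delta_mx i 0.
  by rewrite [LHS]matrix_sum_delta; apply: eq_bigr => i _; rewrite big_ord1.
rewrite linear_sum.
have -> : \sum_i v i 0 *: delta_mx i 0 = v.
  by rewrite [RHS]matrix_sum_delta; apply: eq_bigr => i _; rewrite big_ord1.
apply: eq_bigr => i _; rewrite linearZ mulrC mxE.
by rewrite deriveE.
Qed.

Lemma strongly_convex_grad mu f u v :
  strongly_convex mu f -> differentiable (f : 'cV[R]_n -> R^o) u ->
  f u + dot (grad f u) (v - u) + mu / 2 * dot (v - u) (v - u) <= f v.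
Proof.
move=> sc df; rewrite dot_grad//.
have dr : (fun h : R => h^-1 *: ((f (h *: (v - u) + u) : R^o) - f u)) @ 0^'+ -->
    'D_(v - u) (f : 'cV[R]_n -> R^o) u.
  apply: cvg_dnbhs_at_right.
  have := @diff_derivable _ _ _ _ _ (v-u) df.
  by [].
pose N := dot (v - u) (v - u).
have : 'D_(v - u) (f : 'cV[R]_n -> R^o) u <= f v - f u - mu / 2 * N.
  (* Strong convexity bounds the quotient by the target plus a multiple of [h]; moving this
     vanishing term to the left leaves a bound free of [h], which is closed under limits. *)
  have dr2 : (fun h : R => h^-1 *: ((f (h *: (v - u) + u) : R^o) - f u)
                - h * (mu / 2 * N)) @ 0^'+ -->
      'D_(v - u) (f : 'cV[R]_n -> R^o) u - 0 * (mu / 2 * N).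
    apply: cvgB => //.
    apply: cvg_at_right_filter.
    by apply: cvgMr_tmp; exact: cvg_id.
  rewrite mul0r subr0 in dr2.
  apply: (@closed_cvg _ _ 0^'+ _ _ [set x : R | x <= f v - f u - mu / 2 * N]) dr2.
    exact: closed_le.
  near=> h.
  have h0 : 0 < h by near: h; exact: nbhs_right_gt.
  have h1 : h <= 1 by near: h; exact: nbhs_right_le.
  have := sc v u h; rewrite (ltW h0) h1 => /(_ isT).
  rewrite norm2_sqr -/N.
  have -> : h *: v + (1 - h) *: u = h *: (v - u) + u.
    by rewrite scalerBl scale1r scalerBr addrA addrAC.
  move: (f (h *: (v - u) + u)) => a H /=.
  have -> : h^-1 *: ((a : R^o) - f u) = h^-1 * (a - f u) by [].
  rewrite -(ler_pM2l h0) mulrBr (mulrA h h^-1) mulfV ?gt_eqF// mul1r.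
  by nra.
rewrite /N; lra.
Unshelve. all: end_near.
Qed.

Lemma strong_monotone_grad mu L f u v :
  strongly_convex mu f -> lipschitz_gradient L f ->
  mu * dot (v - u) (v - u) <= dot (grad f v - grad f u) (v - u).
Proof.
move=> sc [df _].
have h1 := strongly_convex_grad v sc (df u).
have h2 := strongly_convex_grad u sc (df v).
move: h1 h2; rewrite -opprB !dotE opprK; lra.
Qed.

(* Convexity replaces the usual integration along the segment, at the price of
   the constant [L] instead of [L / 2]. *)
Lemma lipschitz_gradient_ub mu L f u v : 0 < mu ->
  strongly_convex mu f -> lipschitz_gradient L f ->
  f v <= f u + dot (grad f u) (v - u) + L * dot (v - u) (v - u).
Proof.
move=> mu0 sc [df lip].
have := strongly_convex_grad u sc (df v).
have := dotvv_ge0 (v - u).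
have : dot (grad f v - grad f u) (v - u) <= L * dot (v - u) (v - u).
  apply: le_trans (dot_norm2_le _ _) _.
  rewrite -norm2_sqr expr2 mulrA; apply: ler_wpM2r; first exact: norm2_ge0.
  exact: lip.
rewrite -(opprB v u) !dotE opprK => h1 h2 h3; nra.
Qed.

(** The index [i] supplies a unit vector along which to compare the constants; in dimension zero
    both hypotheses hold for arbitrary [mu] and [L]. *)
Lemma modulus_le_lipschitz (i : 'I_n) mu L f :
  strongly_convex mu f -> lipschitz_gradient L f -> mu <= L.
Proof.
move=> sc lip; pose e : 'cV[R]_n := delta_mx i 0.
have e1 : dot e e = 1 by rewrite dot_delta mxE eqxx.
have := strong_monotone_grad 0 e sc lip; rewrite subr0 e1 mulr1 => /le_trans; apply.
apply: le_trans (dot_norm2_le _ _) _.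
have n1 : norm2 e = 1 by rewrite /norm2 e1 sqrtr1.
have := lip.2 e 0; rewrite subr0 n1 !mulr1.
by [].
Qed.

End FirstOrder.

(** * Extreme eigenvalues *)

Section Spectral.
Context {R : realType}.

Lemma continuous_quadratic_form {n : nat} (S : 'M[R]_n) :
  continuous (fun u : 'rV[R]_n => dot (S *m u^T) u^T).
Proof.
have cc j : continuous (fun u : 'rV[R]_n => u 0 j) by exact: coord_continuous.
have -> : (fun u : 'rV[R]_n => dot (S *m u^T) u^T) =
    (fun u => \sum_i (\sum_j S i j * u 0 j) * u 0 i).
  apply/funext => u; apply: eq_bigr => i _; rewrite !mxE; congr (_ * _).
  by apply: eq_bigr => j _; rewrite mxE.
have sumc (g : 'I_n -> 'rV[R]_n -> R) :
    (forall i, continuous (g i)) -> continuous (fun u => \sum_i g i u).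
  by move=> gc; apply: (@continuous_big R _ +%R) => //; exact: add_continuous.
have linc i : continuous (fun u : 'rV[R]_n => \sum_j S i j * u 0 j).
  apply: (sumc _) => j w; apply: (@continuousM _ _ (fun=> S i j)).
    exact: cst_continuous.
  exact: cc.
by apply: (sumc _) => i u; apply: continuousM; [exact: linc|exact: cc].
Qed.

(** The Rayleigh quotient attains its minimum on the unit sphere of the kernel of [B], and a
    minimizer is an eigenvector because [S] maps this kernel into itself. *)
Lemma rayleigh_min {n k : nat} (S : 'M[R]_n) (B : 'M[R]_(k, n)) (v : 'cV[R]_n) :
  S^T = S -> (forall x : 'cV[R]_n, B *m x = 0 -> B *m (S *m x) = 0) ->
  v != 0 -> B *m v = 0 ->
  exists (l : R) (x : 'cV[R]_n), [/\ x != 0, B *m x = 0, S *m x = l *: x &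
    forall u : 'cV[R]_n, B *m u = 0 -> l * dot u u <= dot (S *m u) u].
Proof.
move=> Ssym Sinv v0 Bv.
pose q (T : 'M[R]_n) (u : 'rV[R]_n) := dot (T *m u^T) u^T.
(* Both constraints, |u| = 1 and B u = 0, are level sets of quadratic forms, so the same continuity
   lemma makes [K] closed. *)
pose K := (q 1%:M @^-1` [set x | x = 1]) `&` (q (B^T *m B) @^-1` [set x | x = 0]).
have K1 u : q 1%:M u = dot u^T u^T by rewrite /q mul1mx.
have KB u : q (B^T *m B) u = 0 <-> B *m u^T = 0.
  rewrite /q -mulmxA dotC -dot_mulmx; split => [/eqP|->]; last by rewrite dot0l.
  by rewrite dotvv_eq0 => /eqP.
have Kcl : closed K.
  apply: closedI; apply: preimage_closed => //.
    by move=> u _; exact: continuous_quadratic_form.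
  by move=> u _; exact: continuous_quadratic_form.
have Kb : bounded_set K.
  exists 1; split; first exact: num_real.
  move=> M M1 u [/= u1 _]; apply: le_trans (ltW M1).
  rewrite /Num.Def.normr/= mx_normrE; apply/bigmax_leP; split => // -[i j] _ /=.
  rewrite -(@ler_pXn2r _ 2)// ?nnegrE// expr1n real_normK ?num_real//.
  rewrite -u1 K1 /dot (bigD1 j)//= !mxE ord1 -expr2 lerDl.
  by apply: sumr_ge0 => s _; rewrite -expr2 sqr_ge0.
have nv0 : 0 < norm2 v by rewrite lt0r norm2_eq0 v0 norm2_ge0.
have normal (u : 'cV[R]_n) : u != 0 -> dot ((norm2 u)^-1 *: u) ((norm2 u)^-1 *: u) = 1.
  move=> u0; rewrite dotZl dotZr -norm2_sqr.
  by field; rewrite norm2_eq0.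
have K0 : K !=set0.
  exists ((norm2 v)^-1 *: v)^T; split => /=; first by rewrite K1 trmxK normal.
  by apply/KB; rewrite trmxK -scalemxAr Bv scaler0.
have [] := @EVT_min_rV _ _ (q S) K K0.
- exact: bounded_closed_compact.
- by apply: continuous_subspaceT => u; exact: continuous_quadratic_form.
move=> c; rewrite inE => -[/= c1 cB] cmin.
pose x := c^T; pose l := q S c.
have x1 : dot x x = 1 by rewrite -c1 K1.
have Bx : B *m x = 0 by apply/KB.
have lmin u : B *m u = 0 -> l * dot u u <= dot (S *m u) u.
  move=> Bu; have [->|u0] := eqVneq u 0; first by rewrite mulmx0 !dot0l mulr0.
  pose w := (norm2 u)^-1 *: u.
  have : l <= q S w^T.
    apply: cmin; rewrite inE; split => /=; first by rewrite K1 trmxK normal.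
    by apply/KB; rewrite trmxK -scalemxAr Bu scaler0.
  have n0 : 0 < norm2 u by rewrite lt0r norm2_eq0 u0 norm2_ge0.
  rewrite /q trmxK -scalemxAr dotZl dotZr -norm2_sqr.
  have -> t : (norm2 u)^-1 * ((norm2 u)^-1 * t) = t / norm2 u ^+ 2.
    by field; rewrite gt_eqF.
  by rewrite ler_pdivlMr// exprn_gt0.
exists l, x; split => //.
  by rewrite -dotvv_eq0 x1 oner_eq0.
apply/eqP; rewrite -subr_eq0; apply/eqP.
(* The residual [d] is an admissible direction. Along x + t d the excess of the form over l |.|^2 is
   nonnegative, vanishes at t = 0 and has linear coefficient 2 |d|^2. *)
move dE : (S *m x - l *: x) => d.
have Bd : B *m d = 0 by rewrite -dE mulmxBr Sinv// -scalemxAr Bx scaler0 subr0.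
apply/eqP; rewrite -dotvv_eq0; apply/eqP.
suff : dot d d *+ 2 = 0 by move/eqP; rewrite mulrn_eq0 => /eqP.
apply: (@linear_coef_eq0 _ _ (dot (S *m d) d - l * dot d d)) => t.
have : B *m (x + t *: d) = 0 by rewrite mulmxDr Bx -scalemxAr Bd scaler0 addr0.
move/lmin; rewrite -subr_ge0 => /le_trans; apply.
have Sd : dot (S *m d) x = dot (S *m x) d by rewrite dot_mulmx Ssym dotC.
have Sx : dot (S *m x) x = l by [].
have dd : dot d d = dot (S *m x) d - l * dot x d by rewrite -{1}dE !dotE.
rewrite mulmxDr -scalemxAr !dotE Sd Sx x1 dd (dotC d x).
by rewrite le_eqVlt; apply/orP; left; apply/eqP; ring.
Qed.

(** The minimum of the Rayleigh quotient of - A^T A, without constraint (B = 0), is minus an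
    eigenvalue of A^T A. *)
Lemma largest_eigenvalueP {n m : nat} (A : 'M[R]_(m, n)) l (x : 'cV[R]_n) :
  largest_eigenvalue (A^T *m A) l -> dot (A *m x) (A *m x) <= l * dot x x.
Proof.
move=> [_ lmax]; have [->|x0] := eqVneq x 0; first by rewrite mulmx0 !dot0l mulr0.
pose S := - (A^T *m A).
have Ssym : S^T = S by rewrite /S linearN /= trmx_mul trmxK.
have [|||k [u [u0 _ Su kmin]]] := @rayleigh_min n 1 S 0 x Ssym => //.
- by move=> y _; rewrite mul0mx.
- by rewrite mul0mx.
have kl : - k <= l.
  apply: lmax; apply/eigenvalueP; exists u^T; last first.
    by apply: contra_neq u0 => /(congr1 trmx); rewrite trmxK trmx0.
  apply: trmx_inj; rewrite trmx_mul !trmxK trmx_mul trmxK linearZ/= trmxK.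
  by rewrite scaleNr -Su /S mulNmx opprK.
have := kmin x; rewrite mul0mx => /(_ erefl).
rewrite /S mulNmx dotNl -mulmxA dotC -dot_mulmx => h.
apply: le_trans (ler_wpM2r (dotvv_ge0 x) kl).
by rewrite mulNr lerNr.
Qed.

(** The minimum of the Rayleigh quotient over the range of A^T is an eigenvalue, and it is positive
    since this range meets the kernel of [A] only in 0. *)
Lemma smallest_positive_eigenvalueP {n m : nat} (A : 'M[R]_(m, n)) l (s : 'cV[R]_m) :
  smallest_positive_eigenvalue (A^T *m A) l ->
  l * dot (A^T *m s) (A^T *m s) <= dot (A *m (A^T *m s)) (A *m (A^T *m s)).
Proof.
move=> [_ _ lmin]; set x := A^T *m s.
have [->|x0] := eqVneq x 0; first by rewrite mulmx0 !dot0l mulr0.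
pose S := A^T *m A.
have Ssym : S^T = S by rewrite /S trmx_mul trmxK.
(* The kernel of this [B] is the range of A^T. *)
pose B := (cokermx A)^T.
have BA (z : 'cV[R]_m) : B *m (A^T *m z) = 0.
  by rewrite /B mulmxA -trmx_mul mulmx_coker trmx0 mul0mx.
have [|||k [u [u0 Bu Su kmin]]] := @rayleigh_min n n S B x Ssym => //.
- by move=> y _; rewrite /S -mulmxA BA.
- exact: BA.
have quad y : dot (S *m y) y = dot (A *m y) (A *m y).
  by rewrite /S -mulmxA dotC -dot_mulmx.
have kp : 0 < k.
  have uu : 0 < dot u u by rewrite lt0r dotvv_eq0 u0 dotvv_ge0.
  rewrite -(pmulr_lgt0 _ uu) -dotZl -Su quad lt0r dotvv_ge0 andbT dotvv_eq0.
  apply: contra_neq u0 => Au.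
  have /submxP[D uD] : (u^T <= A)%MS.
    by rewrite submxE -[cokermx A]trmxK -trmx_mul -/B Bu trmx0.
  apply/eqP; rewrite -dotvv_eq0 -{1}[u]trmxK uD trmx_mul dotC -dot_mulmx.
  by rewrite Au dot0l.
have lk : l <= k.
  apply: lmin kp; apply/eigenvalueP; exists u^T; last first.
    by apply: contra_neq u0 => /(congr1 trmx); rewrite trmxK trmx0.
  by apply: trmx_inj; rewrite trmx_mul trmxK -/S Ssym Su linearZ/= trmxK.
apply: le_trans (ler_wpM2r (dotvv_ge0 x) lk) _.
by rewrite -quad; apply: kmin; exact: BA.
Qed.

End Spectral.

(** * Conjugate of the regularized dual function *)

Section Response.
Context {R : realType} {n m : nat}.

Section Prox.
Variables (h : 'cV[R]_m -> R) (mu L c : R) (y0 s y : 'cV[R]_m).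
Implicit Types v : 'cV[R]_m.
Hypotheses (mu0 : 0 < mu) (c0 : 0 <= c).
Hypotheses (sc : strongly_convex mu h) (lip : lipschitz_gradient L h).
Let hc v := h v + c * dot (v - y0) (v - y0).
Hypothesis ymin : forall v, hc y - dot s y <= hc v - dot s v.

Lemma shifted_sqr v : dot (v - y0) (v - y0) =
  dot (y - y0) (y - y0) + 2 * dot (y - y0) (v - y) + dot (v - y) (v - y).
Proof.
have -> : v - y0 = (y - y0) + (v - y) by apply/colP => i; rewrite !mxE; ring.
by move: (y - y0) (v - y) => a b; rewrite !dotE (dotC b a); ring.
Qed.

(** Fermat's rule, with the upper model of [h] at [y] and the exact expansion of the quadratic
    term. *)
Lemma prox_grad : grad h y = s - (2 * c) *: (y - y0).
Proof.
apply/eqP; rewrite -subr_eq0; apply/eqP.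
apply: (@first_order_eq0 _ _ _ (L + c)) => d.
have := ymin (y + d); have := lipschitz_gradient_ub y (y + d) mu0 sc lip.
rewrite /hc (shifted_sqr (y + d)) [y + d]addrC addrK !dotE; lra.
Qed.

(** The contribution of the regularization to the modulus is discarded, so later rates do not depend
    on [c]. *)
Lemma prox_lower_bound v :
  hc y + dot s (v - y) + mu / 2 * dot (v - y) (v - y) <= hc v.
Proof.
have := strongly_convex_grad v sc (lip.1 y).
have := mulr_ge0 c0 (dotvv_ge0 (v - y)).
have -> : dot (grad h y) (v - y) = dot s (v - y) - 2 * c * dot (y - y0) (v - y).
  by rewrite prox_grad dotDl dotNl dotZl.
rewrite /hc (shifted_sqr v); lra.
Qed.

Lemma prox_upper_bound v :
  hc v <= hc y + dot s (v - y) + (L + c) * dot (v - y) (v - y).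
Proof.
have := lipschitz_gradient_ub y v mu0 sc lip.
have -> : dot (grad h y) (v - y) = dot s (v - y) - 2 * c * dot (y - y0) (v - y).
  by rewrite prox_grad dotDl dotNl dotZl.
rewrite /hc (shifted_sqr v); lra.
Qed.

End Prox.

(* [hc] stands for the regularized [h], and [conj_val x] is the maximum over [y] of
   [<Ax, y - y0> - hc y], attained at [yf x]. Subtracting [y0] matters: the gradient
   at the solution is then bounded in terms of [Ry], whereas the norm of [A^T ys] is
   not controlled by the quantities in [log_factor]. *)
Section Conjugate.
Implicit Types (u x : 'cV[R]_n) (v : 'cV[R]_m).
Variables (A : 'M[R]_(m, n)) (hc : 'cV[R]_m -> R) (mu L : R).
Variables (y0 : 'cV[R]_m) (yf : 'cV[R]_n -> 'cV[R]_m).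
Hypotheses (mu0 : 0 < mu) (L0 : 0 < L).
Hypothesis hc_lb : forall x v,
  hc (yf x) + dot (A *m x) (v - yf x) + mu / 2 * dot (v - yf x) (v - yf x) <= hc v.
Hypothesis hc_ub : forall x v,
  hc v <= hc (yf x) + dot (A *m x) (v - yf x) + L * dot (v - yf x) (v - yf x).

Definition conj_val x := dot (A *m x) (yf x - y0) - hc (yf x).
Definition conj_grad x := A^T *m (yf x - y0).

(** Smoothness of [hc] becomes strong convexity of its conjugate. The gain is measured by |A (u -
    x)|^2, hence is useful only in directions where [A] is bounded below. *)
Lemma conj_lower_bound x u :
  conj_val x + dot (conj_grad x) (u - x)
    + (4 * L)^-1 * dot (A *m (u - x)) (A *m (u - x)) <= conj_val u.
Proof.
rewrite /conj_grad dotC -dot_mulmx /conj_val.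
set d := A *m (u - x).
have Au : A *m u = A *m x + d by rewrite /d mulmxBr addrC subrK.
(* This test point maximizes <d, v - yf x> - L |v - yf x|^2. *)
pose v := yf x + (2 * L)^-1 *: d.
have h1 := hc_ub x v.
have h2 := hc_lb u v.
have h3 : 0 <= mu / 2 * dot (v - yf u) (v - yf u).
  by rewrite mulr_ge0 ?dotvv_ge0// divr_ge0// ltW.
move: h1 h2 h3; set q := mu / 2 * _.
have vx : v - yf x = (2 * L)^-1 *: d by rewrite /v addrC addKr.
rewrite vx Au {Au vx}; clearbody q.
have -> : v - yf u = (yf x - y0) + (2 * L)^-1 *: d - (yf u - y0).
  by rewrite /v; apply/colP => i; rewrite !mxE; ring.
move: (yf x - y0) (yf u - y0) (A *m x) => p pu w.
rewrite !dotE.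
have -> : L * ((2 * L)^-1 * ((2 * L)^-1 * dot d d)) = (4 * L)^-1 * dot d d.
  by field; rewrite gt_eqF.
have -> : (2 * L)^-1 * dot d d = 2 * ((4 * L)^-1 * dot d d).
  by field; rewrite gt_eqF.
lra.
Qed.

(** Strong convexity of [hc] becomes smoothness of its conjugate, by Young's inequality with weight
    [mu]. *)
Lemma conj_upper_bound x u :
  conj_val u <= conj_val x + dot (conj_grad x) (u - x)
    + (2 * mu)^-1 * dot (A *m (u - x)) (A *m (u - x)).
Proof.
rewrite /conj_grad dotC -dot_mulmx /conj_val.
set d := A *m (u - x).
have Au : A *m u = A *m x + d by rewrite /d mulmxBr addrC subrK.
have := hc_lb x (yf u); have := dot_young (yf u - yf x) d mu0.
rewrite Au (dotC _ d).
have -> : yf u - y0 = (yf u - yf x) + (yf x - y0).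
  by apply/colP => i; rewrite !mxE; ring.
rewrite (dotDl _ d) !(dotDr (yf u - yf x) (yf x - y0)).
lra.
Qed.

(** Adding the lower bounds at [x] and [u] gives strong monotonicity of the response; Young's
    inequality then absorbs half of it. *)
Lemma conj_response_lipschitz x u :
  mu ^+ 2 * dot (yf u - yf x) (yf u - yf x) <= dot (A *m (u - x)) (A *m (u - x)).
Proof.
have := hc_lb x (yf u); have := hc_lb u (yf x).
have := dot_young (yf u - yf x) (A *m (u - x)) mu0.
rewrite -(opprB (yf u) (yf x)); move: (yf u - yf x) => d.
rewrite mulmxBr; move: (A *m u) (A *m x) => a b.
rewrite !(dotNr, dotNl) !opprK (dotC d) (dotDl a) dotNl.
set N := dot (a - b) _ => h1 h2 h3.
have : mu / 2 * dot d d <= (2 * mu)^-1 * N by lra.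
rewrite -(ler_pM2l (_ : 0 < 2 * mu)) ?mulr_gt0//.
have -> : 2 * mu * ((2 * mu)^-1 * N) = N by field; rewrite gt_eqF.
by rewrite expr2; lra.
Qed.

End Conjugate.
End Response.

(** * Accelerated gradient steps *)

Section Acceleration.
Context {R : realType} {n : nat}.
Implicit Types (x y z u G : 'cV[R]_n).

Definition potential (nu fx fu : R) z u : R := fx - fu + nu / 2 * dot (z - u) (z - u).

(* Nothing is assumed about [u]: the estimate holds with any reference point
   in place of a minimizer. *)
Lemma accelerated_step (nu M alpha fx fx' fu e : R) x y z z' u G :
  0 < nu -> 0 < M -> 0 <= alpha <= 1 -> alpha ^+ 2 * M = nu ->
  x = (1 + alpha) *: y - alpha *: z ->
  z' = (1 - alpha) *: z + alpha *: y - (alpha / nu) *: G ->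
  fx' <= fx + dot G (y - x) - (2 * M)^-1 * dot G G + e ->
  fx' <= fu + dot G (y - u) - (2 * M)^-1 * dot G G
         - nu / 2 * dot (u - y) (u - y) + e ->
  potential nu fx' fu z' u <= (1 - alpha) * potential nu fx fu z u + e.
Proof.
move=> nu0 M0 /andP[a0 a1] aM -> ->.
have -> : y - ((1 + alpha) *: y - alpha *: z) = alpha *: ((z - u) - (y - u)).
  by rewrite scalerDl scale1r !scalerBr; apply/colP => i; rewrite !mxE; ring.
rewrite -(opprB y u) dotNl dotNr opprK /potential.
have -> : (1 - alpha) *: z + alpha *: y - (alpha / nu) *: G - u =
    (1 - alpha) *: (z - u) + alpha *: (y - u) - (alpha / nu) *: G.
  by apply/colP => i; rewrite !mxE; ring.
move: (y - u) (z - u) => p q.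
rewrite dotZr dotDr dotNr => h1 h2.
have pq := dotvv_ge0 (p - q).
have {h1}h1 : 0 <= (1 - alpha) *
    (fx + alpha * (dot G q - dot G p) - (2 * M)^-1 * dot G G + e - fx').
  by rewrite mulr_ge0// subr_ge0.
have {h2}h2 : 0 <= alpha *
    (fu + dot G p - (2 * M)^-1 * dot G G - nu / 2 * dot p p + e - fx').
  by rewrite mulr_ge0// subr_ge0.
have {pq}h3 : 0 <= nu / 2 * (alpha * (1 - alpha)) * dot (p - q) (p - q).
  apply: mulr_ge0 => //; apply: mulr_ge0; first by rewrite divr_ge0// ltW.
  by rewrite mulr_ge0// subr_ge0.
rewrite -subr_ge0.
(* The gap is the two hypotheses weighted by 1 - alpha and alpha, plus the convexity defect of the
   squared norm; the terms in |G|^2 cancel because alpha^2 M = nu. *)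
suff -> : (1 - alpha) * (fx - fu + nu / 2 * dot q q) + e -
  (fx' - fu + nu / 2 *
     dot ((1 - alpha) *: q + alpha *: p - (alpha / nu) *: G)
         ((1 - alpha) *: q + alpha *: p - (alpha / nu) *: G)) =
  (1 - alpha) *
    (fx + alpha * (dot G q - dot G p) - (2 * M)^-1 * dot G G + e - fx') +
  alpha *
    (fu + dot G p - (2 * M)^-1 * dot G G - nu / 2 * dot p p + e - fx') +
  nu / 2 * (alpha * (1 - alpha)) * dot (p - q) (p - q).
  by rewrite !addr_ge0.
rewrite !dotE (dotC q G) (dotC p G) (dotC q p) -aM.
have a0' : alpha != 0.
  by apply/eqP => z0; move: nu0; rewrite -aM z0 expr0n mul0r ltxx.
by field; rewrite (gt_eqF M0) a0'.
Qed.

End Acceleration.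

(** * Nesterov's method on an invariant subspace *)

Section InnerLoop.
Context {R : realType} {n : nat}.
Implicit Types (d u w x z : 'cV[R]_n).

Section Iteration.
Variables (alpha nu K : R) (df : 'cV[R]_n -> 'cV[R]_n).

(** Nesterov's coupling point: the [y] for which x is the extrapolation (1 + a) y - a z. *)
Definition mid (a : R) x z := (1 + a)^-1 *: (x + a *: z).

Lemma mid_cancel a x z : 0 <= a -> x = (1 + a) *: mid a x z - a *: z.
Proof.
by move=> a0; rewrite scalerA divff ?scale1r ?addrK// gt_eqF// ltr_wpDr.
Qed.

Definition nesterov_step (s : 'cV[R]_n * 'cV[R]_n) :=
  let y := mid alpha s.1 s.2 in
  (y - K^-1 *: df y,
   (1 - alpha) *: s.2 + alpha *: y - (alpha / nu) *: df y).

End Iteration.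

(* Away from the directions in [V] strong convexity may fail, so the iterates
   have to stay in [V]. *)
Section Rate.
Variables (V : 'cV[R]_n -> Prop) (f : 'cV[R]_n -> R) (df : 'cV[R]_n -> 'cV[R]_n).
Variables (nu K : R).
Hypotheses (V0 : V 0) (VD : forall u d, V u -> V d -> V (u + d)).
Hypothesis VZ : forall a u, V u -> V (a *: u).
Hypotheses (nu0 : 0 < nu) (nuK : nu <= K).
Hypothesis df_V : forall u, V u -> V (df u).
Hypothesis f_lb : forall d u, V d -> V u ->
  f d + dot (df d) (u - d) + nu / 2 * dot (u - d) (u - d) <= f u.
Hypothesis f_ub : forall d u,
  f u <= f d + dot (df d) (u - d) + K / 2 * dot (u - d) (u - d).

Let alpha := Num.sqrt (nu / K).
Let iterate N := iter N (nesterov_step alpha nu K df) (0, 0).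

Let K0 : 0 < K. Proof. exact: lt_le_trans nu0 nuK. Qed.

Lemma momentum_sqr : alpha ^+ 2 * K = nu.
Proof. by rewrite sqr_sqrtr ?divr_ge0 ?ltW// divfK// gt_eqF. Qed.

Lemma momentum_itv : 0 <= alpha <= 1.
Proof.
by rewrite sqrtr_ge0 /= -sqrtr1 ler_wsqrtr// ler_pdivrMr// mul1r.
Qed.

Lemma iterate_V N : V (iterate N).1 /\ V (iterate N).2.
Proof.
elim: N => [|N [IH1 IH2]]; first by split.
rewrite /iterate iterS -/(iterate N) /nesterov_step /=.
have Vy : V (mid alpha (iterate N).1 (iterate N).2).
  by apply: VZ; apply: VD => //; exact: VZ.
split; rewrite -scaleNr; apply: VD => //; try by apply: VZ; exact: df_V.
by apply: VD; exact: VZ.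
Qed.

Lemma gradient_descent_step y : f (y - K^-1 *: df y) <=
  f y - (2 * K)^-1 * dot (df y) (df y).
Proof.
apply: le_trans (f_ub y _) _.
rewrite [y - _]addrC addrK dotNr dotZr dotNl dotNr dotZl dotZr.
by rewrite le_eqVlt; apply/orP; left; apply/eqP; field; rewrite gt_eqF.
Qed.

Lemma nesterov_rate N u : V u ->
  potential nu (f (iterate N).1) (f u) (iterate N).2 u <=
  (1 - alpha) ^+ N * potential nu (f 0) (f u) 0 u.
Proof.
move=> Vu; have /andP[a0 a1] := momentum_itv.
elim: N => [|N IH]; first by rewrite expr0 mul1r.
rewrite exprS -mulrA; apply: le_trans (ler_wpM2l _ IH); last by rewrite subr_ge0.
(* The added zero is the error [e] of [accelerated_step]: gradients are exact here. *)
rewrite -[leRHS]addr0 /iterate iterS -/(iterate N).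
have [V1 V2] := iterate_V N.
set x := (iterate N).1; set z := (iterate N).2; set y := mid alpha x z.
have Vy : V y by apply: VZ; apply: VD => //; exact: VZ.
apply: (@accelerated_step _ _ nu K alpha _ _ _ _ x y z _ u (df y)) => //.
- exact: momentum_itv.
- exact: momentum_sqr.
- exact: mid_cancel.
- apply: le_trans (gradient_descent_step y) _; rewrite addr0.
  have := f_lb Vy V1; have := mulr_ge0 (ltW nu0) (dotvv_ge0 (x - y)).
  by rewrite -(opprB y x) !dotNr !dotNl -/x; lra.
- apply: le_trans (gradient_descent_step y) _; rewrite addr0.
  by have := f_lb Vy Vu; rewrite -(opprB y u) !dotNr; lra.
Qed.

(** A gradient step from the last iterate lowers [f] by |df|^2 / (2 K). With the endpoint of that
    step as reference point, the potential dominates this decrease, while its initial value is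
    bounded through df 0 alone. *)
Lemma nesterov_residual N :
  dot (df (iterate N).1) (df (iterate N).1) <=
  4 * K / nu * (1 - alpha) ^+ N * dot (df 0) (df 0).
Proof.
have /andP[a0 a1] := momentum_itv.
have [V1 V2] := iterate_V N.
set x := (iterate N).1 in V1 *; set q := (1 - alpha) ^+ N.
have q0 : 0 <= q by rewrite exprn_ge0// subr_ge0.
pose u := x - K^-1 *: df x.
have Vu : V u by rewrite /u -scaleNr; apply: VD => //; apply: VZ; exact: df_V.
have h1 : f u <= f x - (2 * K)^-1 * dot (df x) (df x) by exact: gradient_descent_step.
have posz v : 0 <= nu / 2 * dot ((iterate N).2 - v) ((iterate N).2 - v).
  by rewrite mulr_ge0 ?dotvv_ge0// divr_ge0// ltW.
have h2 := nesterov_rate N Vu.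
have h3 := f_lb V0 Vu.
(* With reference point 0 the initial potential is zero, so f x <= f 0 and therefore f u <= f 0;
   this controls |u|. *)
have h4 := nesterov_rate N V0.
have pz0 := posz 0; have pzu := posz u.
move: h2 h3 h4; rewrite /potential !subrr dot0l mulr0 addr0 mulr0 !subr0 sub0r dotNl dotNr opprK.
rewrite -/x -/q => h2 h3 h4.
have h5 : nu / 2 * dot u u <= - dot (df 0) u.
  have : 0 <= (2 * K)^-1 * dot (df x) (df x).
    by rewrite mulr_ge0 ?dotvv_ge0// invr_ge0 mulr_ge0// ltW.
  by rewrite subr0 in pz0; lra.
have nu20 : 0 < nu / 2 by rewrite divr_gt0.
have h6 := dot_young (- u) (df 0) nu20.
rewrite dotNl dotNr dotNl opprK (dotC u) in h6.
have {}h6 : - dot (df 0) u <= 2 / nu * dot (df 0) (df 0).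
  move: h6; have -> : (2 * (nu / 2))^-1 * dot (df 0) (df 0) =
    2^-1 * (2 / nu * dot (df 0) (df 0)) by field; rewrite gt_eqF.
  by move: (2 / nu * _) => t; lra.
have h7 : (2 * K)^-1 * dot (df x) (df x) <= q * (2 / nu * dot (df 0) (df 0)).
  apply: le_trans (_ : q * (- dot (df 0) u) <= _); last exact: ler_wpM2l.
  have : q * (f 0 - f u + nu / 2 * dot u u) <= q * (- dot (df 0) u).
    by apply: ler_wpM2l => //; lra.
  by lra.
have K20 : 0 < 2 * K by rewrite mulr_gt0.
move: h7; rewrite -(ler_pM2l K20) mulrA mulfV ?gt_eqF// mul1r => /le_trans; apply.
by rewrite le_eqVlt; apply/orP; left; apply/eqP; field; rewrite gt_eqF.
Qed.

End Rate.
End InnerLoop.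

(** * Inexact accelerated proximal gradient *)

Section OuterLoop.
Context {R : realType} {n : nat}.
Implicit Types (d u w x y z : 'cV[R]_n).

Lemma mid_dist (a : R) x z u : 0 <= a ->
  dot (mid a x z - u) (mid a x z - u) <= dot (x - u) (x - u) + dot (z - u) (z - u).
Proof.
move=> a0; have a1 : 0 < 1 + a by rewrite ltr_wpDr.
have -> : mid a x z - u = (1 + a)^-1 *: ((x - u) + a *: (z - u)).
  by apply/colP => i; rewrite !mxE; field; rewrite gt_eqF.
move: (x - u) (z - u) => p q.
rewrite dotZl dotZr mulrA -invfM -expr2 mulrC ler_pdivrMr ?exprn_gt0//.
have pq := dotvv_ge0 (p - q); have pp := dotvv_ge0 p; have qq := dotvv_ge0 q.
have h1 := mulr_ge0 a0 pq; have h2 := mulr_ge0 a0 pp.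
have h3 := mulr_ge0 (sqr_ge0 a) pp; have h4 := mulr_ge0 a0 qq.
move: h1; rewrite !dotE (dotC q p); lra.
Qed.

Lemma linear_recursion (a : nat -> R) (beta b : R) (N : nat) :
  0 < beta <= 1 -> 0 <= b -> (forall k, a k.+1 <= (1 - beta) * a k + b) ->
  a N <= (1 - beta) ^+ N * a 0 + b / beta.
Proof.
move=> /andP[beta0 beta1] b0 rec; have nb : 0 <= 1 - beta by rewrite subr_ge0.
elim: N => [|N IH]; first by rewrite expr0 mul1r lerDl divr_ge0// ltW.
apply: le_trans (rec N) _; apply: le_trans (lerD (ler_wpM2l nb IH) (lexx b)) _.
by rewrite le_eqVlt; apply/orP; left; apply/eqP; rewrite exprS; field; rewrite gt_eqF.
Qed.

(** [prox] returns the displacement from [w], in accordance with inner problems started at 0; M (y -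
    x') is the gradient mapping and takes the place of the gradient. *)
Definition outer_step (alpha nu M : R) (dr prox : 'cV[R]_n -> 'cV[R]_n)
    (s : 'cV[R]_n * 'cV[R]_n) :=
  let y := mid alpha s.1 s.2 in
  let w := y - M^-1 *: dr y in
  let x' := w + prox w in
  (x', (1 - alpha) *: s.2 + alpha *: y - (alpha / nu) *: (M *: (y - x'))).

(** A step evaluates each map at a single point, so it can be carried out from one oracle answer for
    each. *)
Lemma outer_step_local alpha nu M dr prox s :
  outer_step alpha nu M dr prox s =
  outer_step alpha nu M (fun=> dr (mid alpha s.1 s.2))
    (fun=> prox (mid alpha s.1 s.2 - M^-1 *: dr (mid alpha s.1 s.2))) s.
Proof. by []. Qed.

Section Step.
Variables (mu L : R) (r g : 'cV[R]_n -> R) (dr dg : 'cV[R]_n -> 'cV[R]_n).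
Hypotheses (mu0 : 0 < mu) (muL : mu <= L).
Hypothesis r_lb : forall u x,
  r u + dot (dr u) (x - u) + mu / 2 * dot (x - u) (x - u) <= r x.
Hypothesis r_ub : forall u x,
  r x <= r u + dot (dr u) (x - u) + L * dot (x - u) (x - u).
Hypothesis g_lb : forall u x, g u + dot (dg u) (x - u) <= g x.

Let f x := r x + g x.
Let M := 4 * L.

(** Here [xi] is the residual of the optimality condition of the proximal problem. Half of the
    modulus of [r] and the slack in M = 4 L pay for it. *)
Lemma inexact_prox_step x' y u xi G :
  xi = M *: (x' - y) + dr y + dg x' -> G = M *: (y - x') ->
  f x' <= f u + dot G (y - u) - (2 * M)^-1 * dot G G
          - mu / 2 / 2 * dot (u - y) (u - y) + 2 / mu * dot xi xi.
Proof.
move=> xiE GE.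
have L0 : 0 < L by exact: lt_le_trans mu0 muL.
have M0 : 0 < M by rewrite mulr_gt0.
have dgE : dg x' = xi + G - dr y.
  by rewrite xiE GE; apply/colP => i; rewrite !mxE; ring.
have xyE : x' - y = - (M^-1 *: G).
  by rewrite GE; apply/colP => i; rewrite !mxE; field; rewrite gt_eqF.
have ux : u - x' = (u - y) + M^-1 *: G.
  by rewrite GE; apply/colP => i; rewrite !mxE; field; rewrite gt_eqF.
have := g_lb x' u; have := r_ub y x'; have := r_lb y u.
rewrite /f ux dgE xyE -(opprB y u).
move: (y - u) (dr y) => p D {xiE GE dgE xyE ux}.
have imu : 0 < 2 / mu by rewrite divr_gt0.
have y1 := dot_young xi p imu.
(* Of the available |G|^2 / M, one quarter covers L |x' - y|^2 and one quarter <xi, G> / M; one half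
   remains for the claim. *)
have y2 := dot_young xi (- G) (ltr0Sn R 1).
have {}y2 : 0 <= M^-1 * (dot xi xi + 4^-1 * dot G G + dot xi G).
  apply: mulr_ge0; first by rewrite invr_ge0 ltW.
  move: y2; rewrite dotNr dotNl dotNr opprK.
  have -> : (2%:R * 2%:R)^-1 = 4^-1 :> R by rewrite -natrM.
  by rewrite divff// mul1r; lra.
have y3 : 0 <= (mu^-1 - M^-1) * dot xi xi.
  apply: mulr_ge0; last exact: dotvv_ge0.
  have muM : mu <= M by apply: le_trans muL _; rewrite /M; lra.
  by rewrite subr_ge0 lef_pV2.
have e1 : 2 / mu / 2 = mu^-1 by field; rewrite gt_eqF.
have e2 : (2 * (2 / mu))^-1 = mu / 4 by field; rewrite gt_eqF.
have e4 : L = M / 4 by rewrite /M; field.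
have e5 : (2 * M)^-1 = M^-1 / 2 by field; rewrite gt_eqF.
move: y1 y2 y3; rewrite e1 e2 e4 e5 !dotE !opprK.
have -> : M / 4 * (M^-1 * (M^-1 * dot G G)) = M^-1 / 4 * dot G G.
  by field; rewrite gt_eqF.
rewrite !mulrDr !mulrDl !(mulrN, mulNr, opprK).
lra.
Qed.

End Step.
End OuterLoop.

(* [lra] does not treat [E ^- k] as an atom. *)
Ltac lra_pow := repeat match goal with
  | |- context [@GRing.inv ?a (@GRing.exp ?b ?x ?k)] =>
      move: (@GRing.inv a (@GRing.exp b x k)) => ?
  end; lra.

(** * Outer convergence, with accuracies as powers of [E] *)

Section OuterRate.
Context {R : realType} {n : nat}.
Implicit Types (d u w x y z : 'cV[R]_n).

Lemma ler_powV (E : R) (i j : nat) : 1 <= E -> (i <= j)%N -> E ^- j <= E ^- i.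
Proof.
move=> E1 ij; have E0 : 0 < E by apply: lt_le_trans E1.
by rewrite lef_pV2 ?posrE ?exprn_gt0// ler_weXn2l.
Qed.

(** Trades a numerical factor 2 for one power of [E]; numerical constants are absorbed this way
    throughout. *)
Lemma powV_double (E : R) j : 2 <= E -> 2 * E ^- j.+1 <= E ^- j.
Proof.
move=> E2; have E0 : 0 < E by apply: lt_le_trans E2.
rewrite exprS invfM mulrA -[leRHS]mul1r.
apply: ler_wpM2r; first by rewrite invr_ge0 exprn_ge0// ltW.
by rewrite ler_pdivrMr// mul1r.
Qed.

Lemma pow_double (E : R) j : 2 <= E -> 2 * E ^+ j <= E ^+ j.+1.
Proof.
move=> E2; rewrite exprS; apply: ler_wpM2r => //.
by rewrite exprn_ge0// (le_trans _ E2).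
Qed.

Lemma invr_le (E a : R) : 0 < E -> E^-1 <= a -> a^-1 <= E.
Proof.
move=> E0 Ea; rewrite -[E]invrK lef_pV2 ?posrE ?invr_gt0//.
by apply: lt_le_trans Ea; rewrite invr_gt0.
Qed.

Variables (mu L E c : R) (r g : 'cV[R]_n -> R) (dr dg prox : 'cV[R]_n -> 'cV[R]_n).
Variables (x0 xs : 'cV[R]_n).
Hypotheses (mu0 : 0 < mu) (muL : mu <= L).
Hypothesis r_lb : forall u x,
  r u + dot (dr u) (x - u) + mu / 2 * dot (x - u) (x - u) <= r x.
Hypothesis r_ub : forall u x,
  r x <= r u + dot (dr u) (x - u) + L * dot (x - u) (x - u).
Hypothesis g_lb : forall u x, g u + dot (dg u) (x - u) <= g x.

Let f x := r x + g x.
Let M := 4 * L.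
Let nu := mu / 2.
Let alpha := Num.sqrt (nu / M).
Let iterate N := iter N (outer_step alpha nu M dr prox) (x0, x0).

Hypotheses (E2 : 2 <= E) (muE : E ^-1 <= mu) (LE : L <= E).
Hypothesis prox_residual : forall y,
  let w := y - M^-1 *: dr y in
  dot (M *: prox w + dg (w + prox w)) (M *: prox w + dg (w + prox w))
    <= E ^- 37 * (1 + dot (y - xs) (y - xs)).
Hypotheses (c0 : 0 <= c) (cE : c <= E ^- 34).
Hypothesis growth : forall x, mu / 4 * dot (x - xs) (x - xs) <= f x - f xs + c.
Hypothesis init : f x0 - f xs + nu / 2 * dot (x0 - xs) (x0 - xs) + c <= E ^+ 8.

Let E0 : 0 < E. Proof. exact: lt_le_trans E2. Qed.
Let E1 : 1 <= E. Proof. by apply: le_trans E2; rewrite ler1n. Qed.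
Let L0 : 0 < L. Proof. exact: lt_le_trans muL. Qed.
Let M0 : 0 < M. Proof. by rewrite mulr_gt0. Qed.
Let nu0 : 0 < nu. Proof. by rewrite divr_gt0. Qed.
Let nuM : nu <= M. Proof. by rewrite /nu /M; move: mu0 muL; lra. Qed.

(** The point [xs] minimizes the unregularized function, so [f] may fall below f xs, but by [growth]
    not by more than [c]; the shift keeps the energy nonnegative. *)
Let energy N := potential nu (f (iterate N).1) (f xs) (iterate N).2 xs + c.

Lemma energy_lb N : mu / 4 * (dot ((iterate N).1 - xs) ((iterate N).1 - xs)
   + dot ((iterate N).2 - xs) ((iterate N).2 - xs)) <= energy N.
Proof. by have := growth (iterate N).1; rewrite /energy /potential /nu; lra. Qed.

Let half j : 2 * E ^- j.+1 <= E ^- j. Proof. exact: powV_double. Qed.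
Let muE1 : E ^- 1 <= mu. Proof. by rewrite expr1. Qed.

Lemma momentum_lb : E ^- 3 <= alpha.
Proof.
have E3 : 0 <= E ^- 3 by rewrite invr_ge0 exprn_ge0// ltW.
have /andP[a0 _] : 0 <= alpha <= 1 := momentum_itv nu0 nuM.
rewrite -(ler_pXn2r (ltn0Sn 1)) ?nnegrE//.
rewrite -(ler_pM2r M0) (momentum_sqr nu0 nuM).
apply: (@le_trans _ _ (E ^- 3 ^+ 2 * (4 * E))).
  by apply: ler_wpM2l; [exact: sqr_ge0|rewrite /M; move: LE; lra].
have -> : E ^- 3 ^+ 2 * (4 * E) = 4 * E ^- 5 by field; rewrite gt_eqF.
by rewrite /nu; move: mu0 muE1 (half 1) (half 2) (half 3) (half 4); lra_pow.
Qed.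

(** The proximal residual is relative to |y - xs|^2, which the energy controls. Half of the
    contraction pays for it, leaving the factor 1 - alpha / 2. *)
Lemma energy_step N :
  energy N.+1 <= (1 - alpha / 2) * energy N + (alpha * c + E ^- 35).
Proof.
have aI : 0 <= alpha <= 1 := momentum_itv nu0 nuM; have aM := momentum_sqr nu0 nuM.
have /andP[a0 _] := aI.
rewrite /energy /iterate iterS -/(iterate N).
set x := (iterate N).1; set z := (iterate N).2.
rewrite /outer_step -/x -/z /=; set y := mid alpha x z.
have xiE := prox_residual y; rewrite /= in xiE.
set w := y - M^-1 *: dr y in xiE *; set x' := w + prox w in xiE *.
set G := M *: (y - x'); set xi := M *: prox w + dg x' in xiE.
have xiE' : xi = M *: (x' - y) + dr y + dg x'.
  have -> : M *: (x' - y) = M *: prox w - dr y; last by rewrite subrK.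
  have -> : x' - y = prox w - M^-1 *: dr y.
    by rewrite /x' {1}/w addrAC [y - _]addrC addrK addrC.
  by rewrite scalerBr scalerA divff ?scale1r// gt_eqF.
have main u := inexact_prox_step mu0 muL r_lb r_ub g_lb u xiE' (erefl G).
have := @accelerated_step _ _ nu M alpha (f x) (f x') (f xs) (2 / mu * dot xi xi)
  x y z _ xs G nu0 M0 aI aM (mid_cancel x z a0) (erefl _).
have mainx : f x' <= f x + dot G (y - x) - (2 * M)^-1 * dot G G + 2 / mu * dot xi xi.
  have := main x; have := mulr_ge0 (ltW nu0) (dotvv_ge0 (x - y)).
  by rewrite -/M -/(f x) -/(f x') /nu; lra.
move=> /(_ mainx (main xs)).
have elb := energy_lb N; rewrite -/x -/z /energy -/x -/z in elb.
set p' := potential _ _ _ _ _; set p := potential _ _ _ _ _ in elb *.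
move=> step.
have yd : dot (y - xs) (y - xs) <= E ^+ 3 * (p + c).
  apply: le_trans (mid_dist x z xs a0) _.
  set S := _ + _ in elb *.
  have S0 : 0 <= S by rewrite addr_ge0 ?dotvv_ge0.
  have : E ^- 3 * S <= mu / 4 * S.
    apply: ler_wpM2r => //.
    by move: mu0 muE1 (half 1) (half 2); lra_pow.
  move/le_trans => /(_ _ elb); rewrite mulrC ler_pdivrMr ?exprn_gt0// mulrC.
  by rewrite mulrC.
have e_le : 2 / mu * dot xi xi <= E ^- 35 + alpha / 2 * (p + c).
  have imu : 2 / mu <= E ^+ 2.
    rewrite ler_pdivrMr//; apply: (@le_trans _ _ (E ^+ 2 * E^-1)).
      by rewrite expr2 mulfK ?gt_eqF.
    by rewrite ler_wpM2l// exprn_ge0// ltW.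
  (* The energy appears with coefficient E^(2 - 37 + 3) = E^-32, far below alpha / 2, since alpha >=
     E^-3. *)
  apply: (@le_trans _ _ (E ^+ 2 * (E ^- 37 * (1 + E ^+ 3 * (p + c))))).
    apply: ler_pM => //; first by rewrite divr_ge0// ltW.
      exact: dotvv_ge0.
    apply: le_trans xiE _; apply: ler_wpM2l; first by rewrite invr_ge0 exprn_ge0// ltW.
    by rewrite lerD2l.
  have -> : E ^+ 2 * (E ^- 37 * (1 + E ^+ 3 * (p + c))) = E ^- 35 + E ^- 32 * (p + c).
    by field; rewrite gt_eqF.
  rewrite lerD2l; apply: ler_wpM2r.
    apply: le_trans elb; rewrite mulr_ge0 ?addr_ge0 ?dotvv_ge0//.
    by rewrite divr_ge0// ltW.
  have h4 : E ^- 32 <= E ^- 4 by apply: ler_powV.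
  by move: h4 momentum_lb (half 3); lra_pow.
by lra.
Qed.

Lemma outer_rate N : E ^+ 40 * (1 - alpha / 2) ^+ N <= 1 ->
  dot ((iterate N).1 - xs) ((iterate N).1 - xs) <= E ^- 24.
Proof.
move=> hN; have /andP[a0 a1] : 0 <= alpha <= 1 := momentum_itv nu0 nuM.
have apos : 0 < alpha.
  by apply: lt_le_trans momentum_lb; rewrite invr_gt0 exprn_gt0.
have b0 : 0 <= alpha * c + E ^- 35.
  by rewrite addr_ge0 ?mulr_ge0// invr_ge0 exprn_ge0// ltW.
have bI : 0 < alpha / 2 <= 1 by rewrite divr_gt0//=; lra.
have := linear_recursion N bI b0 energy_step.
(* The floor of the recursion: 2 c from the regularization bias, the other term from the inexact
   proximal maps. *)
have -> : (alpha * c + E ^- 35) / (alpha / 2) = 2 * c + 2 * E ^- 35 / alpha.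
  by field; rewrite !gt_eqF.
set q := (1 - alpha / 2) ^+ N in hN *.
have h1 : q * energy 0 <= E ^- 32.
  have q0 : 0 <= q by rewrite exprn_ge0//; lra.
  apply: (@le_trans _ _ (q * E ^+ 8)); first exact: ler_wpM2l.
  rewrite -[leRHS]mul1r ler_pdivlMr ?exprn_gt0// -mulrA mulrC.
  by rewrite -exprD.
have h2 : E ^- 35 / alpha <= E ^- 32.
  rewrite ler_pdivrMr//; apply: (@le_trans _ _ (E ^- 32 * E ^- 3)).
    by rewrite -invfM -exprD.
  by rewrite ler_wpM2l ?momentum_lb// invr_ge0 exprn_ge0// ltW.
move=> hE.
have h3 : energy N <= E ^- 29.
  have p0 : 0 <= E ^- 35 by rewrite invr_ge0 exprn_ge0// ltW.
  have p1 : 0 <= E ^- 34 by rewrite invr_ge0 exprn_ge0// ltW.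
  move: hE h1 h2 cE p0 p1 (half 33) (half 32) (half 31) (half 30) (half 29).
  by rewrite -mulrA; move: (_ * energy 0) (energy N) (E ^- 35 / alpha) => a b e; lra_pow.
have := energy_lb N; set a := dot _ _; set b := dot _ _ => h4.
have A0 : 0 <= a by exact: dotvv_ge0.
have B0 : 0 <= b by exact: dotvv_ge0.
have h5 : E ^- 3 * a <= mu / 4 * (a + b).
  apply: ler_pM => //; first by rewrite invr_ge0 exprn_ge0// ltW.
    by move: mu0 muE1 (half 1) (half 2); lra_pow.
  by rewrite lerDl.
have h6 : E ^- 3 * a <= E ^- 29 by exact: le_trans h5 (le_trans h4 h3).
have h7 : a <= E ^- 26.
  move: h6; rewrite mulrC ler_pdivrMr ?exprn_gt0//.
  by have -> : E ^- 29 * E ^+ 3 = E ^- 26 by field; rewrite gt_eqF.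
by apply: le_trans h7 _; apply: ler_powV.
Qed.
End OuterRate.

(** * Convergence for the saddle-point problem *)

Section Saddle.
Context {R : realType} {n m : nat}.
Implicit Types (d u w x : 'cV[R]_n) (v y : 'cV[R]_m).

Lemma dotvvD {k : nat} (u v : 'cV[R]_k) :
  dot (u + v) (u + v) <= 2 * dot u u + 2 * dot v v.
Proof. by have := dotvv_ge0 (u - v); rewrite !dotE (dotC v u); lra. Qed.

Lemma dotvv_triangle {k : nat} (u v w : 'cV[R]_k) :
  dot (u - w) (u - w) <= 2 * dot (u - v) (u - v) + 2 * dot (v - w) (v - w).
Proof. by have := dotvvD (u - v) (v - w); rewrite addrA subrK. Qed.

Lemma lipschitz_gradient_sqr {k : nat} L (f : 'cV[R]_k -> R) (u v : 'cV[R]_k) :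
  0 <= L -> lipschitz_gradient L f ->
  dot (grad f u - grad f v) (grad f u - grad f v) <= L ^+ 2 * dot (u - v) (u - v).
Proof.
move=> L0 [_ /(_ u v)]; rewrite norm2_le_sqr ?mulr_ge0 ?norm2_ge0//.
by rewrite exprMn norm2_sqr.
Qed.

Variables (r : 'cV[R]_n -> R) (h : 'cV[R]_m -> R) (A : 'M[R]_(m, n)).
Variables (mux Lx muy Ly lmax lmin : R).
Hypotheses (mux0 : 0 < mux) (muxL : mux <= Lx) (muy0 : 0 < muy) (muyL : muy <= Ly).
Hypotheses (scr : strongly_convex mux r) (lipr : lipschitz_gradient Lx r).
Hypotheses (sch : strongly_convex muy h) (liph : lipschitz_gradient Ly h).
Hypothesis A_ub : forall x, dot (A *m x) (A *m x) <= lmax * dot x x.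
Hypothesis A_lb : forall v,
  lmin * dot (A^T *m v) (A^T *m v) <= dot (A *m (A^T *m v)) (A *m (A^T *m v)).
Hypotheses (lmin0 : 0 < lmin) (lminmax : lmin <= lmax).

Let lmax0 : 0 < lmax. Proof. exact: lt_le_trans lminmax. Qed.
Let Lx0 : 0 < Lx. Proof. exact: lt_le_trans muxL. Qed.
Let Ly0 : 0 < Ly. Proof. exact: lt_le_trans muyL. Qed.

(** Since |A^T v|^2 = <A A^T v, v>, Young's inequality with weight 1 / lmax bounds it by half of
    itself plus lmax |v|^2 / 2. *)
Lemma trmx_ub v : dot (A^T *m v) (A^T *m v) <= lmax * dot v v.
Proof.
have := A_ub (A^T *m v); have il0 : 0 < lmax^-1 by rewrite invr_gt0.
have := dot_young (A *m (A^T *m v)) v il0.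
rewrite [dot (A *m _) v]dot_mulmx.
have -> : (2 * lmax^-1)^-1 = lmax / 2 by field; rewrite gt_eqF.
set a := dot (A^T *m v) _; set b := dot (A *m _) _; set e := dot v v => h1 h2.
have : lmax^-1 / 2 * b <= a / 2.
  rewrite (_ : a / 2 = lmax^-1 / 2 * (lmax * a)); last by field; rewrite gt_eqF.
  by apply: ler_wpM2l => //; rewrite divr_ge0// ltW.
by lra.
Qed.

Variables (x0 xs : 'cV[R]_n) (y0 ys : 'cV[R]_m).
Hypothesis xs_stationary : grad r xs = - (A^T *m ys).
Hypothesis ys_best : forall v, h ys - dot (A *m xs) ys <= h v - dot (A *m xs) v.

Variables (c2 : R) (yf : 'cV[R]_n -> 'cV[R]_m).
Hypotheses (c20 : 0 < c2) (c2L : c2 <= Ly).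
Let hc v := h v + c2 * dot (v - y0) (v - y0).
Hypothesis yf_min : forall x v,
  hc (yf x) - dot (A *m x) (yf x) <= hc v - dot (A *m x) v.

Let hc_lb x v :
  hc (yf x) + dot (A *m x) (v - yf x) + muy / 2 * dot (v - yf x) (v - yf x) <= hc v.
Proof. exact: prox_lower_bound muy0 (ltW c20) sch liph (yf_min x) v. Qed.
Let hc_ub x v :
  hc v <= hc (yf x) + dot (A *m x) (v - yf x) + (Ly + c2) * dot (v - yf x) (v - yf x).
Proof. exact: prox_upper_bound muy0 sch liph (yf_min x) v. Qed.
Let g := conj_val A hc y0 yf.
Let dg := conj_grad A y0 yf.

Lemma best_response_lb v :
  h ys + dot (A *m xs) (v - ys) + muy / 2 * dot (v - ys) (v - ys) <= h v.
Proof.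
(* Optimality of [ys] is the case of zero regularization. *)
have h1 (u : 'cV[R]_m) : h ys + 0 * dot (ys - ys) (ys - ys) - dot (A *m xs) ys <=
    h u + 0 * dot (u - ys) (u - ys) - dot (A *m xs) u.
  by rewrite !mul0r !addr0.
have := prox_lower_bound muy0 (lexx 0) sch liph h1 v.
by rewrite !mul0r !addr0.
Qed.

(** Adds the growth of [h] at [ys] to the optimality of yf xs. It yields both that yf xs is close to
    [ys] and that it is no farther from [y0] than [ys] is. *)
Lemma regularization_bias :
  muy / 2 * dot (yf xs - ys) (yf xs - ys) + c2 * dot (yf xs - y0) (yf xs - y0)
    <= c2 * dot (ys - y0) (ys - y0).
Proof.
have := best_response_lb (yf xs); have := yf_min xs ys.
by rewrite /hc (dotDr _ _ (A *m xs)) (dotNr ys (A *m xs)); lra.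
Qed.

Lemma yf_lipschitz x u : dot (yf u - yf x) (yf u - yf x) <=
  lmax / muy ^+ 2 * dot (u - x) (u - x).
Proof.
have := conj_response_lipschitz muy0 hc_lb x u.
move/le_trans => /(_ _ (A_ub (u - x))).
by rewrite mulrC -ler_pdivlMr ?exprn_gt0// mulrAC.
Qed.

(** * The inner problem *)

Section Inner.
Variable M : R.
Hypothesis M0 : 0 < M.
Let K := M + lmax / muy.
Let nu := M + lmin / (4 * Ly).

Lemma inner_nu0 : 0 < nu.
Proof. by rewrite addr_gt0// divr_gt0// mulr_gt0. Qed.

Lemma inner_nuK : nu <= K.
Proof.
rewrite lerD2l ler_pdivrMr ?mulr_gt0// mulrAC ler_pdivlMr//.
apply: le_trans (_ : lmax * Ly <= _); first exact: ler_pM (ltW _) (ltW _) _ _.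
by have := mulr_ge0 (ltW lmax0) (ltW Ly0); lra.
Qed.

(** The common summand [M] only brings the ratio closer to 1, so the bound does not involve it. *)
Lemma inner_condition : K / nu <= 4 * (Ly * lmax / (muy * lmin)).
Proof.
rewrite ler_pdivrMr ?inner_nu0// /K /nu mulrDr.
have -> : 4 * (Ly * lmax / (muy * lmin)) * (lmin / (4 * Ly)) = lmax / muy.
  by field; rewrite !gt_eqF.
rewrite lerD2r; apply: ler_peMl; first exact: ltW.
rewrite mulrA ler_pdivlMr ?mulr_gt0// mul1r.
apply: le_trans (_ : Ly * lmax <= _); first exact: ler_pM (ltW _) (ltW _) _ _.
by have := mulr_ge0 (ltW Ly0) (ltW lmax0); lra.
Qed.

Let alpha := Num.sqrt (nu / K).

Definition approx_prox N w :=
  (iter N (nesterov_step alpha nu K (fun d => M *: d + dg (w + d))) (0, 0)).1.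

Lemma approx_prox_residual N w :
  let xi := M *: approx_prox N w + dg (w + approx_prox N w) in
  dot xi xi <= 4 * K / nu * (1 - alpha) ^+ N * dot (dg w) (dg w).
Proof.
(* The range of A^T, where the smallest positive eigenvalue yields strong convexity. *)
pose V d := exists s, d = A^T *m s.
pose F d := M / 2 * dot d d + g (w + d).
pose dF d := M *: d + dg (w + d).
have dF0 : dF 0 = dg w by rewrite /dF scaler0 add0r addr0.
rewrite /= -dF0; apply: (@nesterov_residual _ _ V F dF).
- by exists 0; rewrite mulmx0.
- by move=> _ _ [s ->] [t ->]; exists (s + t); rewrite mulmxDr.
- by move=> a _ [s ->]; exists (a *: s); rewrite scalemxAr.
- exact: inner_nu0.
- exact: inner_nuK.
- move=> _ [s ->]; exists (M *: s + (yf (w + A^T *m s) - y0)).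
  by rewrite /dF mulmxDr scalemxAr.
- move=> d u [s ds] [t ut].
  have := conj_lower_bound y0 muy0 _ hc_lb hc_ub (w + d) (w + u).
  have -> : w + u - (w + d) = u - d by rewrite opprD addrACA subrr add0r.
  move/(_ (addr_gt0 Ly0 c20)) => low.
  (* Since c2 <= Ly, regularization at most doubles the smoothness constant, whence 8 Ly. *)
  have spec : lmin / (4 * Ly) / 2 * dot (u - d) (u - d) <=
      (4 * (Ly + c2))^-1 * dot (A *m (u - d)) (A *m (u - d)).
    have -> : u - d = A^T *m (t - s) by rewrite mulmxBr -ut -ds.
    have -> : lmin / (4 * Ly) / 2 = (8 * Ly)^-1 * lmin by field; rewrite gt_eqF.
    rewrite -mulrA; apply: ler_pM.
    + by rewrite invr_ge0 mulr_ge0// ltW.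
    + by rewrite mulr_ge0 ?dotvv_ge0// ltW.
    + rewrite lef_pV2 ?posrE ?mulr_gt0 ?addr_gt0//.
      by move: c2L; lra.
    + exact: A_lb.
  move: low spec; rewrite /F /dF -/g -/dg /nu.
  have -> : dot (M *: d + dg (w + d)) (u - d) =
      M * dot d (u - d) + dot (dg (w + d)) (u - d) by rewrite dotDl dotZl.
  have -> : dot u u = dot d d + 2 * dot d (u - d) + dot (u - d) (u - d).
    have {1 2}-> : u = d + (u - d) by rewrite addrC subrK.
    by move: (u - d) => e; rewrite !dotE (dotC e d); ring.
  by rewrite -/g -/dg; lra.
- move=> d u.
  have := conj_upper_bound y0 muy0 hc_lb (w + d) (w + u).
  have -> : w + u - (w + d) = u - d by rewrite opprD addrACA subrr add0r.
  have spec : (2 * muy)^-1 * dot (A *m (u - d)) (A *m (u - d)) <=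
      lmax / muy / 2 * dot (u - d) (u - d).
    have -> : lmax / muy / 2 = (2 * muy)^-1 * lmax by field; rewrite gt_eqF.
    by rewrite -mulrA ler_wpM2l// invr_ge0 mulr_ge0// ltW.
  move: spec; rewrite /F /dF -/g -/dg /K.
  have -> : dot (M *: d + dg (w + d)) (u - d) =
      M * dot d (u - d) + dot (dg (w + d)) (u - d) by rewrite dotDl dotZl.
  have -> : dot u u = dot d d + 2 * dot d (u - d) + dot (u - d) (u - d).
    have {1 2}-> : u = d + (u - d) by rewrite addrC subrK.
    by move: (u - d) => e; rewrite !dotE (dotC e d); ring.
  by rewrite -/g -/dg; lra.
Qed.

End Inner.

(** * The outer iteration *)

Section Outer.
Variable E : R.
Hypotheses (E2 : 2 <= E) (muxE : E^-1 <= mux) (LxE : Lx <= E) (muyE : E^-1 <= muy).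
Hypotheses (LyE : Ly <= E) (lmaxE : lmax <= E) (lminE : E^-1 <= lmin).
Hypothesis RxE : dot (x0 - xs) (x0 - xs) <= E ^+ 2.
Hypothesis RyE : dot (ys - y0) (ys - y0) <= E ^+ 2.
Hypothesis c2E : c2 = E ^- 40.

Let E0 : 0 < E. Proof. exact: lt_le_trans E2. Qed.
Let E1 : 1 <= E. Proof. by apply: le_trans E2; rewrite ler1n. Qed.

Let double j : 2 * E ^+ j <= E ^+ j.+1. Proof. exact: pow_double. Qed.
Let inv_le a : E^-1 <= a -> a^-1 <= E. Proof. exact: invr_le. Qed.

Let M := 4 * Lx.
Let M0 : 0 < M. Proof. by rewrite mulr_gt0. Qed.

(** Restores the term <A x, y0> removed in [conj_val], so that [f] is the primal function of the
    regularized problem. *)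
Definition shifted_val x := r x + dot (A *m x) y0.
Definition shifted_grad x := grad r x + A^T *m y0.
Let f x := shifted_val x + g x.

Lemma shifted_lb u x : shifted_val u + dot (shifted_grad u) (x - u)
  + mux / 2 * dot (x - u) (x - u) <= shifted_val x.
Proof.
have := strongly_convex_grad x scr (lipr.1 u).
rewrite /shifted_val /shifted_grad (dotDl (grad r u)).
rewrite (dotC (A^T *m y0)) -dot_mulmx mulmxBr (dotDl (A *m x)) dotNl; lra.
Qed.

Lemma shifted_ub u x : shifted_val x <= shifted_val u
  + dot (shifted_grad u) (x - u) + Lx * dot (x - u) (x - u).
Proof.
have := lipschitz_gradient_ub u x mux0 scr lipr.
rewrite /shifted_val /shifted_grad (dotDl (grad r u)).
rewrite (dotC (A^T *m y0)) -dot_mulmx mulmxBr (dotDl (A *m x)) dotNl; lra.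
Qed.

Lemma conj_convex u x : g u + dot (dg u) (x - u) <= g x.
Proof.
have := conj_lower_bound y0 muy0 (addr_gt0 Ly0 c20) hc_lb hc_ub u x.
have : 0 <= (4 * (Ly + c2))^-1 * dot (A *m (x - u)) (A *m (x - u)).
  by rewrite mulr_ge0 ?dotvv_ge0// invr_ge0 mulr_ge0// addr_ge0// ltW.
by rewrite /g /dg; lra.
Qed.

Lemma response_bias : dot (yf xs - ys) (yf xs - ys) <= E ^- 36.
Proof.
have := regularization_bias.
have : 0 <= c2 * dot (yf xs - y0) (yf xs - y0) by rewrite mulr_ge0 ?dotvv_ge0// ltW.
set t := dot (yf xs - ys) _; set a := c2 * dot (yf xs - y0) _ => a0 h1.
have h2 : c2 * dot (ys - y0) (ys - y0) <= E ^- 40 * E ^+ 2.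
  by rewrite c2E; apply: ler_wpM2l => //; rewrite invr_ge0 exprn_ge0// ltW.
have t0 : 0 <= t by exact: dotvv_ge0.
have h3 : E^-1 * t <= 2 * (E ^- 40 * E ^+ 2).
  by have := ler_wpM2r t0 muyE; lra.
rewrite mulrC ler_pdivrMr// in h3; apply: le_trans h3 _.
have -> : E ^- 36 = E ^- 40 * E ^+ 4 by field; rewrite gt_eqF.
have -> : 2 * (E ^- 40 * E ^+ 2) * E = E ^- 40 * (2 * E ^+ 3).
  by field; rewrite gt_eqF.
by apply: ler_wpM2l; first by rewrite invr_ge0 exprn_ge0// ltW.
Qed.

Lemma response_at_solution : dot (yf xs - y0) (yf xs - y0) <= E ^+ 2.
Proof.
have := regularization_bias.
have : 0 <= muy / 2 * dot (yf xs - ys) (yf xs - ys).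
  by rewrite mulr_ge0 ?dotvv_ge0// divr_ge0// ltW.
move=> a0 bias; apply: le_trans RyE; rewrite -(ler_pM2l c20); lra.
Qed.

(** The gradient of [f] at [xs], caused by the regularization alone. *)
Let e := A^T *m (yf xs - ys).
Let c := mux^-1 * dot e e.

Lemma grad_at_solution : shifted_grad xs + dg xs = e.
Proof.
rewrite /shifted_grad xs_stationary /dg /conj_grad /e !mulmxBr.
by apply/colP => i; rewrite !mxE; ring.
Qed.

Lemma bias_ge0 : 0 <= c.
Proof. by rewrite mulr_ge0 ?dotvv_ge0// invr_ge0 ltW. Qed.

Lemma bias_le : c <= E ^- 34.
Proof.
apply: (@le_trans _ _ (E * (E * E ^- 36))); last first.
  by rewrite le_eqVlt; apply/orP; left; apply/eqP; field; rewrite gt_eqF.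
apply: ler_pM; rewrite ?dotvv_ge0 ?invr_ge0 ?(ltW mux0)// ?inv_le//.
apply: le_trans (trmx_ub _) _; apply: ler_pM => //; first exact: ltW.
- exact: dotvv_ge0.
- exact: response_bias.
Qed.

Let dot_e d : - dot e d <= c + mux / 4 * dot d d /\ dot e d <= c + mux / 4 * dot d d.
Proof.
have i0 : 0 < 2 / mux by rewrite divr_gt0.
have e1 : 2 / mux / 2 = mux^-1 by field; rewrite gt_eqF.
have e2 : (2 * (2 / mux))^-1 = mux / 4 by field; rewrite gt_eqF.
have := dot_young e d i0; have := dot_young (- e) d i0.
by rewrite e1 e2 !(dotNl, dotNr) opprK.
Qed.

(** Half of the modulus of [r] pays for the gradient [e], through Young's inequality. *)
Lemma primal_growth x : mux / 4 * dot (x - xs) (x - xs) <= f x - f xs + c.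
Proof.
have := shifted_lb xs x; have := conj_convex xs x.
have [he _] := dot_e (x - xs); rewrite -grad_at_solution dotDl in he.
by rewrite /f; lra.
Qed.

Lemma primal_init :
  f x0 - f xs + mux / 2 / 2 * dot (x0 - xs) (x0 - xs) + c <= E ^+ 8.
Proof.
have := shifted_ub xs x0; have := conj_upper_bound y0 muy0 hc_lb xs x0.
have [_ he] := dot_e (x0 - xs); rewrite -grad_at_solution dotDl in he.
rewrite -/g -/dg /f.
have D0 := dotvv_ge0 (x0 - xs).
set D := dot (x0 - xs) (x0 - xs) in he D0 *.
have h1 : (2 * muy)^-1 * dot (A *m (x0 - xs)) (A *m (x0 - xs)) <= E ^+ 2 * D.
  rewrite expr2 -mulrA; apply: ler_pM; rewrite ?dotvv_ge0 ?invr_ge0//.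
  - by rewrite mulr_ge0// ltW.
  - by apply: inv_le; move: muyE muy0; lra.
  - by apply: le_trans (A_ub _) _; apply: ler_wpM2r.
have h2 : E ^+ 2 * D <= E ^+ 4.
  rewrite (exprD E 2 2); apply: ler_wpM2l => //; exact: sqr_ge0.
have h3 : mux / 2 / 2 * D <= E ^+ 3.
  rewrite exprS; apply: ler_pM => //; first by rewrite !divr_ge0// ltW.
  by move: mux0 muxL LxE; lra.
have h4 : Lx * D <= E ^+ 3.
  by rewrite exprS; apply: ler_pM => //; rewrite ltW.
have h5 : mux / 4 * D <= E ^+ 3.
  rewrite exprS; apply: ler_pM => //; first by rewrite !divr_ge0// ltW.
  by move: mux0 muxL LxE; lra.
have h6 : c <= 1.
  by apply: le_trans bias_le _; rewrite invf_le1 ?exprn_gt0// exprn_ege1.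
have h7 : 1 <= E ^+ 3 by rewrite exprn_ege1.
move: (double 3) (double 4) (double 5) (double 6) (double 7).
by move=> *; lra.
Qed.

Let lipschitz_le : 0 <= lmax / muy ^+ 2 /\ lmax / muy ^+ 2 <= E ^+ 3.
Proof.
split; first by rewrite divr_ge0 ?sqr_ge0// ltW.
rewrite [E ^+ 3]exprS -exprVn; apply: ler_pM => //; [exact: ltW|exact: sqr_ge0|].
by rewrite ler_pXn2r ?nnegrE ?invr_ge0 ?(ltW muy0) ?(ltW E0)// inv_le.
Qed.

(** The inner loop reduces its initial gradient dg w by a known factor, so this gradient must be
    polynomial in [E], relative to the distance to [xs]. *)
Lemma start_gradient_bound (y : 'cV[R]_n) : let w := y - M^-1 *: shifted_grad y in
  dot (dg w) (dg w) <= E ^+ 12 * (1 + dot (y - xs) (y - xs)).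
Proof.
move=> /=; set w := y - M^-1 *: _; set Y := dot (y - xs) (y - xs).
have Y0 : 0 <= Y by exact: dotvv_ge0.
(* At [xs] the shifted gradient is A^T (y0 - ys), hence controlled by the distance of [ys] from
   [y0]. *)
have gs : dot (shifted_grad xs) (shifted_grad xs) <= E ^+ 3.
  rewrite /shifted_grad xs_stationary addrC -mulmxBr exprS.
  apply: le_trans (trmx_ub _) _.
  apply: ler_pM => //; [exact: ltW|exact: dotvv_ge0|].
  by apply: le_trans RyE; rewrite -(opprB ys y0) dotNl dotNr opprK.
have gd : dot (shifted_grad y - shifted_grad xs) (shifted_grad y - shifted_grad xs)
    <= Lx ^+ 2 * Y.
  rewrite /shifted_grad opprD addrACA subrr addr0.
  exact: lipschitz_gradient_sqr (ltW Lx0) lipr.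
have gy := dotvv_triangle (shifted_grad y) (shifted_grad xs) 0.
rewrite !subr0 in gy.
have wd : dot (w - xs) (w - xs) <= E ^+ 6 * (1 + Y).
  have -> : w - xs = (y - xs) - M^-1 *: shifted_grad y by rewrite /w addrAC.
  apply: le_trans (dotvvD _ _) _; rewrite -/Y dotNl dotNr opprK dotZl dotZr.
  have L2 : Lx^-1 ^+ 2 <= E ^+ 2.
    rewrite ler_pXn2r ?nnegrE ?invr_ge0 ?(ltW Lx0) ?(ltW E0)//.
    by apply: inv_le; exact: le_trans muxL.
  have -> : M^-1 * (M^-1 * dot (shifted_grad y) (shifted_grad y)) =
      Lx^-1 ^+ 2 / 16 * dot (shifted_grad y) (shifted_grad y).
    by rewrite /M; field; rewrite gt_eqF.
  have h1 : Lx^-1 ^+ 2 / 16 * dot (shifted_grad y) (shifted_grad y) <=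
      Lx^-1 ^+ 2 / 16 * (2 * (Lx ^+ 2 * Y) + 2 * E ^+ 3).
    apply: ler_wpM2l; first by rewrite divr_ge0// sqr_ge0.
    by apply: le_trans gy _; lra.
  have e1 : Lx^-1 ^+ 2 / 16 * (2 * (Lx ^+ 2 * Y) + 2 * E ^+ 3) =
      Y / 8 + Lx^-1 ^+ 2 * E ^+ 3 / 8 by field; rewrite gt_eqF.
  have h2 : Lx^-1 ^+ 2 * E ^+ 3 <= E ^+ 5.
    by rewrite (exprD E 2 3); apply: ler_wpM2r => //; rewrite exprn_ge0// ltW.
  rewrite e1 in h1.
  have h3 : E ^+ 3 * Y <= E ^+ 6 * Y by apply: ler_wpM2r => //; rewrite ler_weXn2l.
  have h4 : 4 * Y <= E ^+ 3 * Y.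
    by apply: ler_wpM2r => //; move: (double 1) (double 2) E2; rewrite expr1; lra.
  have h5 : 0 <= E ^+ 5 by rewrite exprn_ge0// ltW.
  by move: (double 5); lra.
have yw : dot (yf w - y0) (yf w - y0) <= E ^+ 11 * (1 + Y).
  apply: le_trans (dotvv_triangle _ (yf xs) _) _.
  have h1 := response_at_solution.
  have h2 : dot (yf w - yf xs) (yf w - yf xs) <= E ^+ 9 * (1 + Y).
    apply: le_trans (yf_lipschitz _ _) _; rewrite (exprD E 3 6) -[leRHS]mulrA.
    have [L0 L3] := lipschitz_le.
    by apply: ler_pM => //; exact: dotvv_ge0.
  have h3 : E ^+ 2 <= E ^+ 9 * (1 + Y).
    rewrite -[leLHS]mulr1; apply: ler_pM => //; rewrite ?sqr_ge0 ?ler_weXn2l//.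
    by rewrite lerDl.
  have h4 : 4 * (E ^+ 9 * (1 + Y)) <= E ^+ 11 * (1 + Y).
    rewrite mulrA; apply: ler_wpM2r; first by rewrite addr_ge0.
    by move: (double 9) (double 10); lra.
  by lra.
apply: le_trans (trmx_ub _) _; rewrite exprS -mulrA; apply: ler_pM => //.
- exact: ltW.
- exact: dotvv_ge0.
Qed.

Variable Nin Nout : nat.
Let K := M + lmax / muy.
Let nu := M + lmin / (4 * Ly).
Hypothesis Nin_large : E ^+ 60 * (1 - Num.sqrt (nu / K)) ^+ Nin <= 1.

Lemma inner_residual (y : 'cV[R]_n) : let w := y - M^-1 *: shifted_grad y in
  dot (M *: approx_prox M Nin w + dg (w + approx_prox M Nin w))
      (M *: approx_prox M Nin w + dg (w + approx_prox M Nin w))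
    <= E ^- 37 * (1 + dot (y - xs) (y - xs)).
Proof.
rewrite /=; set w := y - M^-1 *: _; apply: le_trans (approx_prox_residual M0 Nin w) _.
rewrite -/nu -/K; have hN := Nin_large; set q := (1 - _) ^+ Nin in hN *.
have Y0 := dotvv_ge0 (y - xs).
have h1 : 4 * K / nu <= E ^+ 8.
  have := inner_condition M0; rewrite -/nu -/K => cond.
  have h2 : Ly * lmax / (muy * lmin) <= E ^+ 4.
    rewrite invfM (exprD E 2 2) !expr2; apply: ler_pM; rewrite ?mulr_ge0 ?invr_ge0 
      ?(ltW Ly0) ?(ltW lmax0) ?(ltW muy0) ?(ltW lmin0)//.
      by apply: ler_pM; rewrite ?(ltW Ly0) ?(ltW lmax0).
    by apply: ler_pM; rewrite ?invr_ge0 ?(ltW muy0) ?(ltW lmin0) ?inv_le.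
  by move: (double 4) (double 5) (double 6) (double 7); rewrite -mulrA; lra.
have q0 : 0 <= q.
  have /andP[_ a1] := momentum_itv (inner_nu0 M0) (inner_nuK M).
  by rewrite exprn_ge0// subr_ge0.
have h2 : q <= E ^- 60.
  by rewrite -[leRHS]mul1r ler_pdivlMr ?exprn_gt0// mulrC.
(* E^8 from the condition number, E^-60 from the rounds and E^12 from the initial gradient leave
   E^-40. *)
apply: (@le_trans _ _ (E ^+ 8 * E ^- 60 * (E ^+ 12 * (1 + dot (y - xs) (y - xs))))).
  have K0 : 0 <= 4 * K / nu.
    rewrite divr_ge0 ?(ltW (inner_nu0 M0))// mulr_ge0//.
    exact: le_trans (ltW (inner_nu0 M0)) (inner_nuK M).
  apply: ler_pM; [by rewrite mulr_ge0|exact: dotvv_ge0|exact: ler_pM|].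
  exact: start_gradient_bound.
rewrite mulrA; apply: ler_wpM2r; first by rewrite addr_ge0.
have -> : E ^+ 8 * E ^- 60 * E ^+ 12 = E ^- 40 by field; rewrite gt_eqF.
exact: ler_powV.
Qed.

Let alpha := Num.sqrt (mux / 2 / M).
Hypothesis Nout_large : E ^+ 40 * (1 - alpha / 2) ^+ Nout <= 1.

Definition outer_result :=
  (iter Nout (outer_step alpha (mux / 2) M shifted_grad (approx_prox M Nin))
     (x0, x0)).1.

Lemma outer_result_close : dot (outer_result - xs) (outer_result - xs) <= E ^- 24.
Proof.
exact: (outer_rate mux0 muxL shifted_lb shifted_ub conj_convex E2 muxE LxE
  inner_residual bias_ge0 bias_le primal_growth primal_init Nout_large).
Qed.

Lemma response_close :
  dot (yf outer_result - ys) (yf outer_result - ys) <= E ^- 18.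
Proof.
apply: le_trans (dotvv_triangle _ (yf xs) _) _.
have h1 := response_bias.
have h2 : dot (yf outer_result - yf xs) (yf outer_result - yf xs) <= E ^- 21.
  have -> : E ^- 21 = E ^+ 3 * E ^- 24 by field; rewrite gt_eqF.
  apply: le_trans (yf_lipschitz _ _) _.
  have [L0 L3] := lipschitz_le.
  by apply: ler_pM => //; [exact: dotvv_ge0|exact: outer_result_close].
have h3 : E ^- 36 <= E ^- 21 by exact: ler_powV.
have h4 : 4 * E ^- 21 <= E ^- 18.
  have -> : E ^- 18 = E ^+ 3 * E ^- 21 by field; rewrite gt_eqF.
  apply: ler_wpM2r; first by rewrite invr_ge0 exprn_ge0// ltW.
  by move: (double 1) (double 2) E2; rewrite expr1; lra.
by move: h1 h2 h3 h4; lra_pow.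
Qed.

End Outer.
End Saddle.

(** * From distances to the duality gap *)

Section Certificate.
Context {R : realType} {n m : nat}.
Variables (p : saddle_problem R n m) (mux Lx muy Ly lmax : R).
Local Notation r := (pr p).
Local Notation h := (ph p).
Local Notation A := (pA p).
Hypotheses (mux0 : 0 < mux) (muy0 : 0 < muy) (lmax0 : 0 < lmax).
Hypotheses (scr : strongly_convex mux r) (lipr : lipschitz_gradient Lx r).
Hypotheses (sch : strongly_convex muy h) (liph : lipschitz_gradient Ly h).
Hypothesis A_ub : forall x, dot (A *m x) (A *m x) <= lmax * dot x x.
Variables (xs : 'cV[R]_n) (ys : 'cV[R]_m).
Hypothesis ys_best : best_response p xs ys.

Let ys_min v : h ys - dot (A *m xs) ys <= h v - dot (A *m xs) v.
Proof. by have := ys_best v; lra. Qed.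

Let h_lb := best_response_lb muy0 sch liph ys_min.

Lemma best_response_grad : grad h ys = A *m xs.
Proof.
have h1 (u : 'cV[R]_m) : h ys + 0 * dot (ys - ys) (ys - ys) - dot (A *m xs) ys <=
    h u + 0 * dot (u - ys) (u - ys) - dot (A *m xs) u.
  by rewrite !mul0r !addr0.
by rewrite (prox_grad muy0 sch liph h1) mulr0 scale0r subr0.
Qed.

(** Strong concavity at [ys] absorbs the change of slope A (x - xs). The bound makes the supremum
    finite and gives an upper model of the primal function. *)
Lemma dual_value_ub (x : 'cV[R]_n) y : dot (A *m x) y - h y <=
  dot (A *m x) ys - h ys + lmax / (2 * muy) * dot (x - xs) (x - xs).
Proof.
have := h_lb y; have := dot_young (y - ys) (A *m (x - xs)) muy0.
have : (2 * muy)^-1 * dot (A *m (x - xs)) (A *m (x - xs)) <=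
    lmax / (2 * muy) * dot (x - xs) (x - xs).
  rewrite [lmax / _]mulrC -mulrA; apply: ler_wpM2l => //.
  by rewrite invr_ge0 mulr_ge0// ltW.
rewrite (dotC (y - ys) (A *m _)) mulmxBr.
rewrite (dotDl (A *m x) (- (A *m xs)) (y - ys)) dotNl.
rewrite (dotDr y (- ys) (A *m x)) (dotDr y (- ys) (A *m xs)) !dotNr; lra.
Qed.

Lemma has_sup_dual_value (x : 'cV[R]_n) :
  has_sup [set dot (A *m x) y - h y | y in [set: 'cV[R]_m]].
Proof.
split; first by exists (dot (A *m x) ys - h ys), ys.
by eexists => _ [y _ <-]; exact: dual_value_ub.
Qed.

Lemma primal_ub (x : 'cV[R]_n) : primal p x <=
  saddle p x ys + lmax / (2 * muy) * dot (x - xs) (x - xs).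
Proof.
rewrite /primal /saddle -!addrA lerD2l addrA; apply: ge_sup.
  by have [] := has_sup_dual_value x.
by move=> _ [y _ <-]; exact: dual_value_ub.
Qed.

Lemma primal_lb (x : 'cV[R]_n) y : saddle p x y <= primal p x.
Proof.
rewrite /primal /saddle -addrA lerD2l; apply: sup_upper_bound.
  exact: has_sup_dual_value.
by exists y.
Qed.

(** Fermat's rule for the upper model of [primal], a substitute for Danskin's theorem. *)
Lemma minimizer_stationary : minimizer (primal p) xs -> grad r xs = - (A^T *m ys).
Proof.
move=> xs_min; apply/eqP; rewrite -addr_eq0; apply/eqP.
apply: (@first_order_eq0 _ _ _ (Lx + lmax / (2 * muy))) => d.
have h1 := xs_min (xs + d); have h2 := primal_ub (xs + d).
have h3 := primal_lb xs ys; have h4 := lipschitz_gradient_ub xs (xs + d) mux0 scr lipr.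
move: h1 h2 h3 h4; rewrite /saddle [xs + d]addrC addrK mulmxDr !(dotDl, dotE).
by rewrite (dotC (A^T *m ys)) -dot_mulmx; lra.
Qed.

Hypothesis xs_stationary : grad r xs = - (A^T *m ys).
Variables (xh : 'cV[R]_n) (yh : 'cV[R]_m).

Lemma saddle_lb (x : 'cV[R]_n) : saddle p xs yh
  - lmax / (2 * mux) * dot (yh - ys) (yh - ys) <= saddle p x yh.
Proof.
have := strongly_convex_grad x scr (lipr.1 xs).
have ml0 : 0 < mux / lmax by rewrite divr_gt0.
have := dot_young (A *m (x - xs)) (ys - yh) ml0.
have : mux / lmax / 2 * dot (A *m (x - xs)) (A *m (x - xs)) <=
    mux / 2 * dot (x - xs) (x - xs).
  have -> : mux / 2 = mux / lmax / 2 * lmax by field; rewrite gt_eqF.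
  by rewrite -[leRHS]mulrA; apply: ler_wpM2l => //; rewrite divr_ge0// ltW.
have -> : (2 * (mux / lmax))^-1 = lmax / (2 * mux) by field; rewrite !gt_eqF.
have -> : dot (ys - yh) (ys - yh) = dot (yh - ys) (yh - ys).
  by rewrite -(opprB yh ys) dotNl dotNr opprK.
rewrite xs_stationary dotNl (dotC (A^T *m ys)) -dot_mulmx /saddle.
have -> : dot (A *m (x - xs)) (ys - yh) =
    dot (A *m (x - xs)) ys - (dot (A *m x) yh - dot (A *m xs) yh).
  by rewrite mulmxBr dotDr dotNr (dotDl _ _ yh) dotNl.
lra.
Qed.

Lemma saddle_xs_yh_lb : saddle p xs ys - Ly * dot (yh - ys) (yh - ys) <= saddle p xs yh.
Proof.
have := lipschitz_gradient_ub ys yh muy0 sch liph.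
by rewrite best_response_grad /saddle (dotDr yh (- ys) (A *m xs)) dotNr; lra.
Qed.

Lemma saddle_xs_yh_ub :
  saddle p xs yh <= saddle p xs ys - muy / 2 * dot (yh - ys) (yh - ys).
Proof.
have := h_lb yh.
by rewrite /saddle (dotDr yh (- ys) (A *m xs)) dotNr; lra.
Qed.

Lemma saddle_xh_ys_ub : saddle p xh ys <= saddle p xs ys + Lx * dot (xh - xs) (xh - xs).
Proof.
have := lipschitz_gradient_ub xs xh mux0 scr lipr.
rewrite xs_stationary dotNl (dotC (A^T *m ys)) -dot_mulmx /saddle mulmxBr.
by rewrite (dotDl (A *m xh)) dotNl; lra.
Qed.

(* The first condition, [yh] being not too close to [ys], replaces the usual
   requirement that the best response to [xh] lie in the ball around [y0],
   which cannot be guaranteed when [ys] is close to [y0]. *)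
Lemma eps_solution_of_close eps x0 y0 :
  lmax * dot (xh - xs) (xh - xs) <= muy ^+ 2 * dot (yh - ys) (yh - ys) ->
  (Lx + lmax / (2 * muy)) * dot (xh - xs) (xh - xs)
    + (Ly + lmax / (2 * mux)) * dot (yh - ys) (yh - ys) <= eps ->
  eps_solution p eps x0 y0 (norm2 (x0 - xs)) (norm2 (y0 - ys)) xs xh yh.
Proof.
move=> far close; rewrite /eps_solution /=.
set X := dot (xh - xs) (xh - xs) in far close *.
set Y := dot (yh - ys) (yh - ys) in far close *.
set SY := [set saddle p xh y | y in _]%classic.
set SX := [set saddle p x yh | x in _]%classic.
have SYub y : saddle p xh y <= saddle p xh ys + lmax / (2 * muy) * X.
  exact: le_trans (primal_lb _ _) (primal_ub _).
have ys_in : SY (saddle p xh ys).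
  exists ys => //; rewrite /ball2 /= norm2_distC.
  by rewrite ler_peMl ?norm2_ge0// ler1n.
have xs_in : SX (saddle p xs yh).
  exists xs => //; rewrite /ball2 /= norm2_distC.
  by rewrite ler_peMl ?norm2_ge0// ler1n.
have SY_le : sup SY <= saddle p xh ys + lmax / (2 * muy) * X.
  by apply: ge_sup; [exists (saddle p xh ys)|move=> _ [y _ <-]].
have SX_ge : saddle p xs yh - lmax / (2 * mux) * Y <= inf SX.
  apply: lb_le_inf; [by exists (saddle p xs yh)|move=> _ [x _ <-]].
  exact: saddle_lb.
have SY_ge : saddle p xh ys <= sup SY.
  apply: sup_upper_bound => //; split; first by exists (saddle p xh ys).
  by eexists => _ [y _ <-]; exact: SYub.
have SX_le : inf SX <= saddle p xs yh.
  apply: (ge_inf _ xs_in).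
  by eexists => _ [x _ <-]; exact: saddle_lb.
have h1 := primal_ub xh; have h2 := primal_lb xs ys.
have h3 := saddle_xs_yh_lb; have h4 := saddle_xs_yh_ub; have h5 := saddle_xh_ys_ub.
rewrite -/X -/Y in h1 h3 h4 h5.
(* As [yh] is away from [ys], the value at (xs, yh) lies below that at (xs, ys) by at least the
   amount by which primal xh may exceed the value at (xh, ys); thus the gap dominates the primal
   error. *)
have h6 : lmax / (2 * muy) * X <= muy / 2 * Y.
  have -> : muy / 2 * Y = (2 * muy)^-1 * (muy ^+ 2 * Y) by field; rewrite gt_eqF.
  rewrite [lmax / _]mulrC -mulrA; apply: ler_wpM2l => //.
  by rewrite invr_ge0 mulr_ge0// ltW.
by split; lra.
Qed.

End Certificate.

(** * The method *)

Section Algorithm.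
Context {R : realType} {n m : nat}.
Implicit Types (x w : 'cV[R]_n) (s : 'cV[R]_n * 'cV[R]_n).

Section Loops.
Variables (y0 : 'cV[R]_m) (c2 : {posnum R}).

(** The term - 2 c2 y0 completes the square and recentres the proximal quadratic at [y0]. *)
Definition call_response x (k : 'cV[R]_m -> method R n m) : method R n m :=
  CallA x (fun a => CallProx (- a - (2 * c2%:num) *: y0) c2 k).

Section Inner.
Variables (alpha nu K M : R) (w : 'cV[R]_n).

(** Continuation-passing style: [k] receives the last iterate, which lets the loops nest. *)
Fixpoint inner_loop (N : nat) s (k : 'cV[R]_n -> method R n m) : method R n m :=
  if N is N'.+1 then
    let v := mid alpha s.1 s.2 in
    call_response (w + v) (fun y => CallAT (y - y0) (fun t =>
      inner_loop N' (nesterov_step alpha nu K (fun=> M *: v + t) s) k))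
  else k s.1.

End Inner.

Variables (alpha nu M : R) (alphaF nuF KF : R) (Nin : nat) (b0 : 'cV[R]_n).

Fixpoint outer_loop (N : nat) s (k : 'cV[R]_n -> method R n m) : method R n m :=
  if N is N'.+1 then
    CallGrad (mid alpha s.1 s.2) (fun gr =>
      inner_loop alphaF nuF KF M (mid alpha s.1 s.2 - M^-1 *: (gr + b0)) Nin (0, 0)
        (fun d => outer_loop N'
           (outer_step alpha nu M (fun=> gr + b0) (fun=> d) s) k))
  else k s.1.

End Loops.

Definition add_counts (o : outcome) (g t a q : nat) : @outcome R n m :=
  Outcome (out_x o) (out_y o)
    (g + num_grad o) (t + num_AT o) (a + num_A o) (q + num_prox o).

Lemma add_countsD o g t a q g' t' a' q' :
  add_counts (add_counts o g t a q) g' t' a' q' =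
  add_counts o (g' + g) (t' + t) (a' + a) (q' + q).
Proof. by rewrite /add_counts /= !addnA. Qed.

Section Run.
Variables (p : saddle_problem R n m) (prox : 'cV[R]_m -> {posnum R} -> 'cV[R]_m).

Lemma run_grad x k : run p prox (CallGrad x k) =
  add_counts (run p prox (k (grad (pr p) x))) 1 0 0 0.
Proof. by rewrite /=; case: (run _ _ _). Qed.

Lemma run_AT y k : run p prox (CallAT y k) =
  add_counts (run p prox (k ((pA p)^T *m y))) 0 1 0 0.
Proof. by rewrite /=; case: (run _ _ _). Qed.

Lemma run_A x k : run p prox (CallA x k) =
  add_counts (run p prox (k (pA p *m x))) 0 0 1 0.
Proof. by rewrite /=; case: (run _ _ _). Qed.

Lemma run_prox c1 c2 k : run p prox (CallProx c1 c2 k) =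
  add_counts (run p prox (k (prox c1 c2))) 0 0 0 1.
Proof. by rewrite /=; case: (run _ _ _). Qed.

Variables (y0 : 'cV[R]_m) (c2 : {posnum R}).

Definition response x := prox (- (pA p *m x) - (2 * c2%:num) *: y0) c2.

Lemma run_response x k : run p prox (call_response y0 c2 x k) =
  add_counts (run p prox (k (response x))) 0 0 1 1.
Proof. by rewrite run_A run_prox add_countsD. Qed.

Lemma run_inner_loop alpha nu K M w N s k :
  run p prox (inner_loop y0 c2 alpha nu K M w N s k) =
  add_counts (run p prox (k (iter N (nesterov_step alpha nu K
    (fun d => M *: d + conj_grad (pA p) y0 response (w + d))) s).1)) 0 N N N.
Proof.
elim: N s => [|N IH] s; first by rewrite /=; case: (run _ _ _).
by rewrite run_response run_AT IH !add_countsD iterSr.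
Qed.

Lemma run_outer_loop alpha nu M alphaF nuF KF Nin b0 N s k :
  run p prox (outer_loop y0 c2 alpha nu M alphaF nuF KF Nin b0 N s k) =
  add_counts (run p prox (k (iter N (outer_step alpha nu M
      (fun x => grad (pr p) x + b0)
      (fun w => (iter Nin (nesterov_step alphaF nuF KF
         (fun d => M *: d + conj_grad (pA p) y0 response (w + d))) (0, 0)).1)) s).1))
    N (N * Nin) (N * Nin) (N * Nin).
Proof.
elim: N s => [|N IH] s; first by rewrite /=; case: (run _ _ _).
rewrite run_grad run_inner_loop IH !add_countsD iterSr.
by rewrite [outer_step _ _ _ _ _ s in RHS]outer_step_local !add0n add1n mulSn.
Qed.

End Run.

(** The successor makes the count exceed k T / a, so that (1 - a)^N <= exp (- k T). *)
Definition rounds (k : nat) (T a : R) : nat := (Num.trunc (k%:R * T / a)).+1.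

Variables (c : constants R) (eps : R) (x0 : 'cV[R]_n) (y0 : 'cV[R]_m).

Definition outer_K := 4 * Lx c.
Definition outer_alpha := Num.sqrt (mux c / 2 / outer_K).
Definition inner_K := outer_K + lmax c / muy c.
Definition inner_nu := outer_K + lmin c / (4 * Ly c).
Definition inner_alpha := Num.sqrt (inner_nu / inner_K).

(** The counterpart of [log_factor] available to the method: a computed bound [D] stands for the
    unknown distances. *)
Definition log_size (D : R) := 1 + `|ln eps| + `|ln (mux c)| + `|ln (muy c)|
  + `|ln (Lx c)| + `|ln (Ly c)| + `|ln (lmax c)| + `|ln (lmin c)| + ln (1 + D).

(* [G] and [- 2 (y1 - y0)] are the partial gradients of the saddle function at
   [(x0, y1)], where [y1] is the first proximal answer: strong monotonicity bounds
   the distances to the solution by them. *)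
Definition distance_bound (G : 'cV[R]_n) (y1 : 'cV[R]_m) : R :=
  let P := dot (y1 - y0) (y1 - y0) in
  let W := dot G G / mux c + 4 * P / muy c in
  2 * P + W / mux c + 2 * W / muy c.

Lemma regularization_gt0 (T : R) : 0 < expR T ^- 40.
Proof. by rewrite invr_gt0 exprn_gt0// expR_gt0. Qed.

(** Written without an index, so that it is defined for m = 0 too. *)
Definition first_unit : 'cV[R]_m := \col_i (val i == 0%N)%:R.

(* The final dual point is moved away from the computed one by twice the accuracy, so
   that it is at a known distance from [ys]; see [eps_solution_of_close]. *)
Definition saddle_method : method R n m :=
  CallGrad x0 (fun g0 =>
  call_response y0 1%:pos x0 (fun y1 =>
  CallAT y1 (fun t1 =>
  CallAT y0 (fun b0 =>
  let T := log_size (distance_bound (g0 + t1) y1) in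
  let c2 := PosNum (regularization_gt0 T) in
  outer_loop y0 c2 outer_alpha (mux c / 2) outer_K inner_alpha inner_nu inner_K
    (rounds 60 T inner_alpha) b0 (rounds 80 T outer_alpha) (x0, x0)
    (fun x => call_response y0 c2 x (fun y =>
       Return x (y + (2 * expR T ^- 9) *: first_unit))))))).

End Algorithm.

(** * Iteration counts and the initial bound *)

Section Rounds.
Context {R : realType}.
Implicit Types (T a q : R).

Lemma rounds_large k l T a : 0 < a -> a <= 1 -> (l <= k)%N -> 0 <= T ->
  expR T ^+ l * (1 - a) ^+ rounds k T a <= 1.
Proof.
move=> a0 a1 lk T0; set N := rounds k T a.
have hN : k%:R * T <= a * N%:R.
  have kT0 : 0 <= k%:R * T / a by rewrite divr_ge0 ?mulr_ge0// ltW.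
  have /andP[_] := truncn_itv kT0.
  by rewrite ltr_pdivrMr// [_ * a]mulrC => /ltW.
have h1 : (1 - a) ^+ N <= expR (- (a * N%:R)).
  rewrite -mulNr expRM_natr; apply: lerXn2r; rewrite ?nnegrE ?subr_ge0 ?expR_ge0//.
  exact: expR_ge1Dx.
apply: (@le_trans _ _ (expR (k%:R * T) * expR (- (a * N%:R)))).
  apply: ler_pM; rewrite ?exprn_ge0 ?expR_ge0 ?subr_ge0//.
  by rewrite -expRM_natl ler_expR ler_wpM2r// ler_nat.
rewrite -expRD -[leRHS]expR0 ler_expR. by rewrite subr_le0.
Qed.

Lemma rounds_le k T a b : 0 <= T -> 0 <= b -> 0 < a -> a^-1 <= b ->
  (rounds k T a)%:R <= k%:R * T * b + 1.
Proof.
move=> T0 b0 a0 ab; rewrite /rounds -natr1 lerD2r.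
apply: (@le_trans _ _ (k%:R * T / a)).
  by rewrite truncn_le divr_ge0 ?mulr_ge0// ltW.
by apply: ler_wpM2l => //; rewrite mulr_ge0.
Qed.

Lemma ln_le_expR q T : 0 < q -> ln q <= T -> q <= expR T.
Proof. by move=> q0 h; rewrite -[q]lnK ?posrE// ler_expR. Qed.

Lemma norm_ln_bounds q T : 0 < q -> `|ln q| <= T -> q <= expR T /\ (expR T)^-1 <= q.
Proof.
move=> q0; rewrite ler_norml => /andP[h1 h2]; split; first exact: ln_le_expR.
by rewrite -[leRHS]lnK ?posrE// -expRN ler_expR.
Qed.

End Rounds.

(** * The computed distance bound *)

Section InitialBound.
Context {R : realType} {n m : nat}.
Variables (p : saddle_problem R n m) (c : constants R).
Local Notation r := (pr p).
Local Notation h := (ph p).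
Local Notation A := (pA p).
Local Notation mux := (mux c).
Local Notation muy := (muy c).
Local Notation Lx := (Lx c).
Local Notation Ly := (Ly c).
Local Notation lmax := (lmax c).
Hypotheses (mux0 : 0 < mux) (muy0 : 0 < muy) (lmax0 : 0 < lmax) (muxL : mux <= Lx).
Hypotheses (scr : strongly_convex mux r) (lipr : lipschitz_gradient Lx r).
Hypotheses (sch : strongly_convex muy h) (liph : lipschitz_gradient Ly h).
Hypothesis A_ub : forall x, dot (A *m x) (A *m x) <= lmax * dot x x.
Variables (x0 xs : 'cV[R]_n) (y0 ys y1 : 'cV[R]_m).
Hypothesis ys_best : best_response p xs ys.
Hypothesis xs_stationary : grad r xs = - (A^T *m ys).
Hypothesis y1_min : forall v, h y1 + 1 * dot (y1 - y0) (y1 - y0) - dot (A *m x0) y1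
  <= h v + 1 * dot (v - y0) (v - y0) - dot (A *m x0) v.

Let G := grad r x0 + A^T *m y1.
Let P := dot (y1 - y0) (y1 - y0).
Let W := dot G G / mux + 4 * P / muy.
Let D := distance_bound c y0 G y1.

(** The bilinear terms cancel when the monotonicity inequalities of [r] and [h] are added; Young's
    inequality absorbs half of the left side. *)
Lemma strong_monotone_saddle :
  mux * dot (x0 - xs) (x0 - xs) + muy * dot (y1 - ys) (y1 - ys) <= W.
Proof.
have h1 := strong_monotone_grad xs x0 scr lipr.
have h2 := strong_monotone_grad ys y1 sch liph.
rewrite (best_response_grad muy0 sch liph ys_best) in h2.
rewrite (prox_grad muy0 sch liph y1_min) in h2.
rewrite xs_stationary opprK in h1.
have i1 : 0 < mux^-1 by rewrite invr_gt0.
have i2 : 0 < 2 / muy by rewrite divr_gt0.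
have y1' := dot_young G (x0 - xs) i1.
have y2' := dot_young (- (y1 - y0)) (y1 - ys) i2.
move: h1 h2 y1' y2'; rewrite dotNl dotNr dotNl opprK /W /P.
have -> : (2 * mux^-1)^-1 = mux / 2 by field; rewrite gt_eqF.
have -> : (2 * (2 / muy))^-1 = muy / 4 by field; rewrite gt_eqF.
have -> : grad r x0 + A^T *m ys = G - A^T *m (y1 - ys).
  by rewrite /G mulmxBr; apply/colP => i; rewrite !mxE; ring.
have -> : A *m x0 - (2 * 1) *: (y1 - y0) - A *m xs =
    A *m (x0 - xs) - (2 * 1) *: (y1 - y0).
  by rewrite mulmxBr; apply/colP => i; rewrite !mxE; ring.
have -> : dot (G - A^T *m (y1 - ys)) (x0 - xs) =
    dot G (x0 - xs) - dot (A *m (x0 - xs)) (y1 - ys).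
  by rewrite dotDl dotNl (dotC (A^T *m _)) -dot_mulmx.
have -> : dot (A *m (x0 - xs) - (2 * 1) *: (y1 - y0)) (y1 - ys) =
    dot (A *m (x0 - xs)) (y1 - ys) - 2 * dot (y1 - y0) (y1 - ys).
  by rewrite [LHS]dotDl dotNl dotZl mulr1.
have -> : mux^-1 / 2 * dot G G = dot G G / mux / 2 by field; rewrite gt_eqF.
have -> : 2 / muy / 2 * dot (y1 - y0) (y1 - y0) = dot (y1 - y0) (y1 - y0) / muy.
  by field; rewrite gt_eqF.
have -> : 4 * dot (y1 - y0) (y1 - y0) / muy = 4 * (dot (y1 - y0) (y1 - y0) / muy).
  by rewrite mulrA.
lra.
Qed.

(** Starts the converse estimate, of computed quantities by the true distances: the optimality of
    [y1] is tested at [ys]. *)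
Lemma initial_response_ub : P <= dot (ys - y0) (ys - y0)
  + lmax / (2 * muy) * dot (x0 - xs) (x0 - xs).
Proof.
have := dual_value_ub muy0 sch liph A_ub ys_best x0 y1.
by have := y1_min ys; rewrite !mul1r /P; lra.
Qed.

Let P0 : 0 <= P. Proof. exact: dotvv_ge0. Qed.
Let X0 : 0 <= dot (x0 - xs) (x0 - xs). Proof. exact: dotvv_ge0. Qed.
Let Q0 : 0 <= dot (y1 - ys) (y1 - ys). Proof. exact: dotvv_ge0. Qed.
Let W0 : 0 <= W.
Proof. by rewrite addr_ge0 ?divr_ge0 ?mulr_ge0 ?dotvv_ge0// ltW. Qed.
Let Wx0 : 0 <= W / mux. Proof. by rewrite divr_ge0// ltW. Qed.
Let Wy0 : 0 <= 2 * W / muy. Proof. by rewrite divr_ge0 ?mulr_ge0// ltW. Qed.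

Let DE : D = 2 * P + W / mux + 2 * W / muy. Proof. by []. Qed.

Lemma distance_bound_ge0 : 0 <= D.
Proof. by rewrite DE !addr_ge0// mulr_ge0. Qed.

Lemma distance_bound_x : dot (x0 - xs) (x0 - xs) <= D.
Proof.
have h1 : dot (x0 - xs) (x0 - xs) <= W / mux.
  rewrite ler_pdivlMr// mulrC; apply: le_trans strong_monotone_saddle.
  by rewrite lerDl mulr_ge0// ltW.
by rewrite DE; move: P0 Wy0; lra.
Qed.

Lemma distance_bound_y : dot (ys - y0) (ys - y0) <= D.
Proof.
have h1 : dot (y1 - ys) (y1 - ys) <= W / muy.
  rewrite ler_pdivlMr// mulrC; apply: le_trans strong_monotone_saddle.
  by rewrite lerDr mulr_ge0// ltW.
have := dotvv_triangle ys y1 y0; rewrite -/P.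
have -> : dot (ys - y1) (ys - y1) = dot (y1 - ys) (y1 - ys).
  by rewrite -(opprB y1 ys) dotNl dotNr opprK.
by rewrite DE -mulrA; move: Wx0; lra.
Qed.

Variable F : R.
Hypotheses (F2 : 2 <= F) (muxF : F^-1 <= mux) (LxF : Lx <= F) (muyF : F^-1 <= muy).
Hypothesis lmaxF : lmax <= F.
Hypothesis RxF : dot (x0 - xs) (x0 - xs) <= F ^+ 2.
Hypothesis RyF : dot (ys - y0) (ys - y0) <= F ^+ 2.

(** Ensures that the logarithm of the computed bound is at most 17 times that of [F], which will be
    the exponential of [log_factor]. *)
Lemma distance_bound_le : 1 + D <= F ^+ 17.
Proof.
have F0 : 0 < F by exact: lt_le_trans F2.
have F1 : 1 <= F by apply: le_trans F2; rewrite ler1n.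
have Lx0 : 0 < Lx by exact: lt_le_trans muxL.
have double j : 2 * F ^+ j <= F ^+ j.+1 by exact: pow_double.
have inv_le a : F^-1 <= a -> a^-1 <= F by exact: invr_le.
have mono i j : (i <= j)%N -> F ^+ i <= F ^+ j by move=> ij; rewrite ler_weXn2l.
have pow0 i : 0 <= F ^+ i by rewrite exprn_ge0// ltW.
have hP : P <= F ^+ 5.
  apply: le_trans initial_response_ub _.
  have : lmax / (2 * muy) * dot (x0 - xs) (x0 - xs) <= F ^+ 4.
    rewrite (exprD F 2 2); apply: ler_pM => //.
      by rewrite divr_ge0 ?mulr_ge0// ltW.
    rewrite expr2; apply: ler_pM; rewrite ?invr_ge0 ?mulr_ge0 ?(ltW lmax0) ?(ltW muy0)//.
    by apply: inv_le; move: muyF muy0; lra.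
  by move: (double 4) (mono 2 4 isT) RyF; lra.
have hQ : dot (y1 - ys) (y1 - ys) <= F ^+ 7.
  apply: le_trans (dotvv_triangle _ y0 _) _; rewrite -/P.
  have -> : dot (y0 - ys) (y0 - ys) = dot (ys - y0) (ys - y0).
    by rewrite -(opprB ys y0) dotNl dotNr opprK.
  by move: (double 5) (double 6) (mono 2 5 isT) RyF; lra.
have hG : dot G G <= F ^+ 10.
  have -> : G = (grad r x0 - grad r xs) + A^T *m (y1 - ys).
    by rewrite xs_stationary /G mulmxBr; apply/colP => i; rewrite !mxE; ring.
  apply: le_trans (dotvvD _ _) _.
  have h1 : dot (grad r x0 - grad r xs) (grad r x0 - grad r xs) <= F ^+ 4.
    apply: le_trans (lipschitz_gradient_sqr _ _ (ltW Lx0) lipr) _.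
    rewrite (exprD F 2 2); apply: ler_pM => //; first exact: sqr_ge0.
    by rewrite ler_pXn2r ?nnegrE ?(ltW Lx0) ?(ltW F0).
  have h2 : dot (A^T *m (y1 - ys)) (A^T *m (y1 - ys)) <= F ^+ 8.
    apply: le_trans (trmx_ub A_ub lmax0 (lexx _) _) _.
    by rewrite exprS; apply: ler_pM => //; exact: ltW.
  by move: (double 8) (double 9) (mono 4 8 isT); lra.
have hW : W <= F ^+ 12.
  have h1 : dot G G / mux <= F ^+ 11.
    rewrite exprSr; apply: ler_pM; rewrite ?dotvv_ge0 ?invr_ge0 ?(ltW mux0)//.
    exact: inv_le.
  have h2 : P / muy <= F ^+ 6.
    by rewrite exprSr; apply: ler_pM; rewrite ?invr_ge0 ?(ltW muy0)// inv_le.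
  rewrite /W -[4 * P / muy]mulrA.
  by move: (double 6) (double 7) (double 11) (mono 8 11 isT); lra.
have hWx : W / mux <= F ^+ 13.
  by rewrite exprSr; apply: ler_pM; rewrite ?invr_ge0 ?(ltW mux0)// inv_le.
have hWy : W / muy <= F ^+ 13.
  by rewrite exprSr; apply: ler_pM; rewrite ?invr_ge0 ?(ltW muy0)// inv_le.
rewrite DE -[2 * W / muy]mulrA.
move: (double 13) (double 14) (double 15) (double 16) (mono 0 13 isT) (mono 5 13 isT).
by rewrite expr0; lra.
Qed.

End InitialBound.

(** * Correctness and cost *)

Section Cost.
Context {R : realType} {n m : nat}.

Lemma response_min (p : saddle_problem R n m) prox (y0 : 'cV[R]_m) (c2 : {posnum R})
    (x : 'cV[R]_n) (v : 'cV[R]_m) : prox_solver (ph p) prox ->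
  let y := response p prox y0 c2 x in
  ph p y + c2%:num * dot (y - y0) (y - y0) - dot (pA p *m x) y <=
  ph p v + c2%:num * dot (v - y0) (v - y0) - dot (pA p *m x) v.
Proof.
move=> ps /=; have := ps (- (pA p *m x) - (2 * c2%:num) *: y0) c2 v.
rewrite -/(response p prox y0 c2 x); move: (response _ _ _ _ _) => y.
rewrite !norm2_sqr.
have shift u : dot (- (pA p *m x) - (2 * c2%:num) *: y0) u =
    - dot (pA p *m x) u - 2 * c2%:num * dot y0 u.
  by rewrite dotDl !dotNl dotZl.
have sqr (u : 'cV[R]_m) : dot (u - y0) (u - y0) = dot u u - 2 * dot y0 u + dot y0 y0.
  by rewrite !dotE (dotC u y0); ring.
by rewrite !shift !sqr; lra.
Qed.

Lemma run_saddle_method (p : saddle_problem R n m) prox c eps x0 y0 :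
  let y1 := response p prox y0 1%:pos x0 in
  let G := grad (pr p) x0 + (pA p)^T *m y1 in
  let T := log_size c eps (distance_bound c y0 G y1) in
  let yf := response p prox y0 (PosNum (regularization_gt0 T)) in
  let Nin := rounds 60 T (inner_alpha c) in
  let Nout := rounds 80 T (outer_alpha c) in
  let x := outer_result (pr p) (pA p) (mux c) (Lx c) (muy c) (Ly c) (lmax c) (lmin c)
             x0 y0 yf Nin Nout in
  run p prox (saddle_method c eps x0 y0) =
  Outcome x (yf x + (2 * expR T ^- 9) *: first_unit)
    Nout.+1 (Nout * Nin).+2 (Nout * Nin).+2 (Nout * Nin).+2.
Proof.
move=> y1 G T yf Nin Nout x.
rewrite /saddle_method run_grad run_response !run_AT run_outer_loop run_response.
rewrite !add_countsD /add_counts.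
cbn [run out_x out_y num_grad num_AT num_A num_prox].
by rewrite !addn0 !addn1 !add1n.
Qed.

Lemma first_unit_norm (i : 'I_m) : norm2 (@first_unit R m) = 1.
Proof.
rewrite /norm2 /dot (bigD1 (Ordinal (leq_ltn_trans (leq0n i) (ltn_ord i))))//=.
rewrite !mxE /= mulr1 big1 ?addr0 ?sqrtr1// => j; rewrite !mxE -val_eqE /= => /negbTE ->.
by rewrite mulr0.
Qed.

End Cost.

Section LogBounds.
Context {R : realType}.
Variables (c : constants R) (eps S : R).
Hypotheses (eps0 : 0 < eps) (mux0 : 0 < mux c) (muy0 : 0 < muy c) (Lx0 : 0 < Lx c).
Hypotheses (Ly0 : 0 < Ly c) (lmax0 : 0 < lmax c) (lmin0 : 0 < lmin c).
Hypothesis S_ge : 1 + `|ln eps| + `|ln (mux c)| + `|ln (muy c)|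
  + `|ln (Lx c)| + `|ln (Ly c)| + `|ln (lmax c)| + `|ln (lmin c)| <= S.

(** Applied twice: to the quantity [T] computed by the method and to [log_factor]. *)
Lemma log_bounds : [/\ 1 <= S, 2 <= expR S, (expR S)^-1 <= eps,
  [/\ (expR S)^-1 <= mux c, Lx c <= expR S, (expR S)^-1 <= muy c & Ly c <= expR S]
  & lmax c <= expR S /\ (expR S)^-1 <= lmin c].
Proof.
have := normr_ge0 (ln eps); have := normr_ge0 (ln (mux c)).
have := normr_ge0 (ln (muy c)); have := normr_ge0 (ln (Lx c)).
have := normr_ge0 (ln (Ly c)); have := normr_ge0 (ln (lmax c)).
have := normr_ge0 (ln (lmin c)).
have b1 := norm_ln_bounds eps0; have b2 := norm_ln_bounds mux0.
have b3 := norm_ln_bounds muy0; have b4 := norm_ln_bounds Lx0.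
have b5 := norm_ln_bounds Ly0; have b6 := norm_ln_bounds lmax0.
have b7 := norm_ln_bounds lmin0.
move: `|ln eps| `|ln (mux c)| `|ln (muy c)| `|ln (Lx c)| `|ln (Ly c)|
  `|ln (lmax c)| `|ln (lmin c)| S_ge b1 b2 b3 b4 b5 b6 b7.
move=> t1 t2 t3 t4 t5 t6 t7 hS b1 b2 b3 b4 b5 b6 b7 p7 p6 p5 p4 p3 p2 p1.
have S1 : 1 <= S by lra.
have [_ e1] : eps <= expR S /\ (expR S)^-1 <= eps by apply: b1; lra.
have [_ e2] : mux c <= expR S /\ (expR S)^-1 <= mux c by apply: b2; lra.
have [_ e3] : muy c <= expR S /\ (expR S)^-1 <= muy c by apply: b3; lra.
have [e4 _] : Lx c <= expR S /\ (expR S)^-1 <= Lx c by apply: b4; lra.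
have [e5 _] : Ly c <= expR S /\ (expR S)^-1 <= Ly c by apply: b5; lra.
have [e6 _] : lmax c <= expR S /\ (expR S)^-1 <= lmax c by apply: b6; lra.
have [_ e7] : lmin c <= expR S /\ (expR S)^-1 <= lmin c by apply: b7; lra.
by split=> //; apply: le_trans (expR_ge1Dx S); lra.
Qed.

End LogBounds.

(** Absorbs the two calls made outside the inner loops into a product of the two loop bounds. *)
Lemma loop_count_le (a b : nat) : ((a * b).+2 <= a.+1 * b.+2)%N.
Proof.
rewrite mulSn !addSn !ltnS; apply: leq_trans (leq_addl _ _).
by rewrite leq_mul2l ltnW ?orbT.
Qed.

(** * Accuracy and number of calls of the method *)

Section Main.
Context {R : realType} {n m : nat}.
Variables (c : constants R) (eps : R) (x0 : 'cV[R]_n) (y0 : 'cV[R]_m).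
Variables (p : saddle_problem R n m) (prox : 'cV[R]_m -> {posnum R} -> 'cV[R]_m).
Variables (xs : 'cV[R]_n) (ys : 'cV[R]_m).
Hypotheses (eps0 : 0 < eps) (cls : in_class c p) (prox_ok : prox_solver (ph p) prox).
Hypotheses (xs_min : minimizer (primal p) xs) (ys_best : best_response p xs ys).

Let mux0 := class_mux cls.
Let muy0 := class_muy cls.
Let scr := class_r_convex cls.
Let lipr := class_r_smooth cls.
Let sch := class_h_convex cls.
Let liph := class_h_smooth cls.
Let A_ub x := largest_eigenvalueP x (class_lmax cls).
Let A_lb v := smallest_positive_eigenvalueP v (class_lmin cls).

Let lmin0 : 0 < lmin c. Proof. by have [] := class_lmin cls. Qed.
Let lminmax : lmin c <= lmax c.
Proof. by have [e _ _] := class_lmin cls; have [_] := class_lmax cls; apply. Qed.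
Let lmax0 : 0 < lmax c. Proof. exact: lt_le_trans lminmax. Qed.

(** A nonzero matrix has an entry, so both dimensions are positive. *)
Let dims : ('I_n * 'I_m)%type.
Proof.
have : exists i, exists j, pA p i j != 0 by apply/matrix0Pn; exact: class_A cls.
by move=> /cid[i /cid[j _]].
Qed.

Let muxL : mux c <= Lx c. Proof. exact (modulus_le_lipschitz dims.1 scr lipr). Qed.
Let muyL : muy c <= Ly c. Proof. exact (modulus_le_lipschitz dims.2 sch liph). Qed.
Let Lx0 : 0 < Lx c. Proof. exact: lt_le_trans muxL. Qed.
Let Ly0 : 0 < Ly c. Proof. exact: lt_le_trans muyL. Qed.

Let xs_stationary : grad (pr p) xs = - ((pA p)^T *m ys).
Proof. exact (minimizer_stationary mux0 muy0 scr lipr sch liph A_ub ys_best xs_min). Qed.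

Let ys_min v : ph p ys - dot (pA p *m xs) ys <= ph p v - dot (pA p *m xs) v.
Proof. by have := ys_best v; lra. Qed.

Let y1 := response p prox y0 1%:pos x0.
Let y1_min v := response_min y0 1%:pos x0 v prox_ok.
Let G := grad (pr p) x0 + (pA p)^T *m y1.
Let D := distance_bound c y0 G y1.
Let T := log_size c eps D.
Let E := expR T.

Let D0 : 0 <= D. Proof. exact: distance_bound_ge0. Qed.

Let T_bounds : [/\ 1 <= T, 2 <= E, E^-1 <= eps,
  [/\ E^-1 <= mux c, Lx c <= E, E^-1 <= muy c & Ly c <= E]
  & lmax c <= E /\ E^-1 <= lmin c].
Proof.
apply: log_bounds => //; rewrite /T /log_size.
have : 0 <= ln (1 + D) by rewrite ln_ge0// lerDl.
by lra.
Qed.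

Let T1 : 1 <= T. Proof. by have [] := T_bounds. Qed.
Let E2 : 2 <= E. Proof. by have [] := T_bounds. Qed.
Let E0 : 0 < E. Proof. exact: expR_gt0. Qed.
Let E1 : 1 <= E. Proof. by apply: le_trans E2; rewrite ler1n. Qed.

Let D_le : D <= E ^+ 2.
Proof.
have h : 1 + D <= E.
  apply: ln_le_expR; first by rewrite ltr_pwDl.
  rewrite /T /log_size.
  have := normr_ge0 (ln eps); have := normr_ge0 (ln (mux c)).
  have := normr_ge0 (ln (muy c)); have := normr_ge0 (ln (Lx c)).
  have := normr_ge0 (ln (Ly c)); have := normr_ge0 (ln (lmax c)).
  have := normr_ge0 (ln (lmin c)).
  by lra.
apply: le_trans (_ : E <= _); first by lra.
by rewrite expr2 ler_peMl// ltW.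
Qed.

Let c2 : {posnum R} := PosNum (regularization_gt0 T).
Let yf := response p prox y0 c2.
Let Nin := rounds 60 T (inner_alpha c).
Let Nout := rounds 80 T (outer_alpha c).
Let xh := outer_result (pr p) (pA p) (mux c) (Lx c) (muy c) (Ly c) (lmax c) (lmin c)
            x0 y0 yf Nin Nout.

Let outer_nu0 : 0 < mux c / 2. Proof. by rewrite divr_gt0. Qed.
Let outer_nuK : mux c / 2 <= outer_K c.
Proof. by move: mux0 muxL; rewrite /outer_K; lra. Qed.
Let outer_K0 : 0 < outer_K c. Proof. by rewrite mulr_gt0. Qed.

Let outer_alpha_itv : 0 < outer_alpha c <= 1.
Proof.
have /andP[_ ->] := momentum_itv outer_nu0 outer_nuK.
by rewrite sqrtr_gt0 divr_gt0.
Qed.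

Let inner_nu_gt0 : 0 < inner_nu c. Proof. exact (inner_nu0 muy0 muyL lmin0 outer_K0). Qed.
Let inner_nu_le : inner_nu c <= inner_K c. Proof. exact (inner_nuK muy0 muyL lmin0 lminmax _). Qed.

Let inner_alpha_itv : 0 < inner_alpha c <= 1.
Proof.
have /andP[_ ->] := momentum_itv inner_nu_gt0 inner_nu_le.
by rewrite sqrtr_gt0 divr_gt0// (lt_le_trans inner_nu_gt0).
Qed.

Let iterates_close : dot (xh - xs) (xh - xs) <= E ^- 24 /\
  dot (yf xh - ys) (yf xh - ys) <= E ^- 18.
Proof.
have [_ _ _ [muxE LxE muyE LyE] [lmaxE lminE]] := T_bounds.
have c2L : c2%:num <= Ly c.
  apply: le_trans muyL; apply: le_trans muyE.
  by have := ler_powV E1 (isT : (1 <= 40)%N); rewrite expr1.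
have yf_min x v := response_min y0 c2 x v prox_ok.
have RxE : dot (x0 - xs) (x0 - xs) <= E ^+ 2.
  exact: le_trans (distance_bound_x mux0 muy0 scr lipr sch liph ys_best xs_stationary y1_min) D_le.
have RyE : dot (ys - y0) (ys - y0) <= E ^+ 2.
  exact: le_trans (distance_bound_y mux0 muy0 scr lipr sch liph ys_best xs_stationary y1_min) D_le.
have [a0 a1] := andP outer_alpha_itv; have [b0 b1] := andP inner_alpha_itv.
have Nin_large : E ^+ 60 * (1 - inner_alpha c) ^+ Nin <= 1.
  by apply: rounds_large => //; apply: le_trans T1.
have Nout_large : E ^+ 40 * (1 - outer_alpha c / 2) ^+ Nout <= 1.
  (* The energy contracts at rate alpha / 2 only, hence 80 in the method for the required 40. *)
  have -> : Nout = rounds 40 T (outer_alpha c / 2).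
    rewrite /Nout /rounds; congr (Num.trunc _).+1.
    by field; rewrite gt_eqF.
  apply: rounds_large => //; [by rewrite divr_gt0| |exact: le_trans T1].
  by rewrite ler_pdivrMr// mul1r (le_trans a1)// ler1n.
split.
- exact (outer_result_close mux0 muxL muy0 muyL scr lipr sch liph A_ub A_lb lmin0
    lminmax xs_stationary ys_min (regularization_gt0 T) c2L yf_min E2 muxE LxE muyE LyE
    lmaxE lminE RxE RyE (erefl _) Nin_large Nout_large).
- exact (response_close mux0 muxL muy0 muyL scr lipr sch liph A_ub A_lb lmin0
    lminmax xs_stationary ys_min (regularization_gt0 T) c2L yf_min E2 muxE LxE muyE LyE
    lmaxE lminE RxE RyE (erefl _) Nin_large Nout_large).
Qed.

Lemma saddle_method_correct :
  let res := run p prox (saddle_method c eps x0 y0) in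
  eps_solution p eps x0 y0 (norm2 (x0 - xs)) (norm2 (y0 - ys)) xs (out_x res) (out_y res).
Proof.
move=> res; rewrite /res run_saddle_method -/y1 -/G -/D -/T -/E -/c2 -/yf -/Nin -/Nout -/xh {res}.
simpl out_x; simpl out_y.
have [_ _ epsE [muxE LxE muyE LyE] [lmaxE lminE]] := T_bounds.
have [hx hy] := iterates_close.
set yh := yf xh + _.
have pow0 i : 0 < E ^- i by rewrite invr_gt0 exprn_gt0.
have half j : 2 * E ^- j.+1 <= E ^- j by exact: powV_double.
have yb : norm2 (yf xh - ys) <= E ^- 9.
  rewrite norm2_le_sqr ?(ltW (pow0 9))//.
  by have -> : E ^- 9 ^+ 2 = E ^- 18 by field; rewrite gt_eqF.
have un : norm2 ((2 * E ^- 9) *: (@first_unit R m)) = 2 * E ^- 9.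
  by rewrite norm2Z (first_unit_norm dims.2) mulr1 ger0_norm// mulr_ge0// ltW.
have yhE : yh - ys = (yf xh - ys) + (2 * E ^- 9) *: first_unit by rewrite /yh addrAC.
have yh_le : norm2 (yh - ys) <= 3 * E ^- 9.
  by rewrite yhE; apply: le_trans (norm2D _ _) _; rewrite un; move: yb; lra_pow.
(* The shift has length 2 E^-9 and starts within E^-9 of [ys]. *)
have yh_ge : E ^- 9 <= norm2 (yh - ys).
  have := norm2D (yh - ys) (- (yf xh - ys)).
  by rewrite {1}yhE norm2N addrAC subrr add0r un; move: yb; lra_pow.
have Y_le : dot (yh - ys) (yh - ys) <= 9 * E ^- 18.
  have : 0 <= 3 * E ^- 9 by rewrite mulr_ge0// ltW.
  move=> h3; move: yh_le; rewrite norm2_le_sqr//.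
  by have -> : (3 * E ^- 9) ^+ 2 = 9 * E ^- 18 by field; rewrite gt_eqF.
have Y_ge : E ^- 18 <= dot (yh - ys) (yh - ys).
  have -> : E ^- 18 = E ^- 9 ^+ 2 by field; rewrite gt_eqF.
  by rewrite -norm2_sqr ler_pXn2r ?nnegrE ?norm2_ge0// ltW.
have X0 := dotvv_ge0 (xh - xs); have Y0 := dotvv_ge0 (yh - ys).
have inv_le a : E^-1 <= a -> a^-1 <= E by exact: invr_le.
apply: (eps_solution_of_close mux0 muy0 lmax0 scr lipr sch liph A_ub ys_best xs_stationary).
(* The primal error E^-24 was made much smaller than the squared shift: E^-23 against E^-20. *)
- apply: (@le_trans _ _ (E * E ^- 24)); first by apply: ler_pM => //; exact: ltW.
  apply: (@le_trans _ _ (E^-1 ^+ 2 * E ^- 18)).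
    have -> : E * E ^- 24 = E ^- 23 by field; rewrite gt_eqF.
    have -> : E^-1 ^+ 2 * E ^- 18 = E ^- 20 by field; rewrite gt_eqF.
    exact: ler_powV.
  apply: ler_pM => //; rewrite ?sqr_ge0 ?(ltW (pow0 18))//.
  by rewrite ler_pXn2r ?nnegrE ?(ltW muy0)// invr_ge0 ltW.
have kappa (L l mu : R) : 0 < L -> L <= E -> 0 < l -> l <= E -> 0 < mu -> E^-1 <= mu ->
    0 <= L + l / (2 * mu) /\ L + l / (2 * mu) <= E ^+ 3.
  move=> L1 L2 l1 l2 m1 m2; split.
    by rewrite addr_ge0 ?divr_ge0 ?mulr_ge0// ltW.
  have h1 : l / (2 * mu) <= E ^+ 2.
    rewrite expr2; apply: ler_pM; rewrite ?invr_ge0 ?mulr_ge0 ?(ltW l1) ?(ltW m1)//.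
    by apply: inv_le; move: m1 m2; lra.
  have h2 : E <= E ^+ 2 by rewrite expr2 ler_peMl// ltW.
  have h3 : 2 * E ^+ 2 <= E ^+ 3 by rewrite exprS; apply: ler_wpM2r => //; exact: sqr_ge0.
  by lra.
have [kx0 kx] := kappa _ _ _ Lx0 LxE lmax0 lmaxE muy0 muyE.
have [ky0 ky] := kappa _ _ _ Ly0 LyE lmax0 lmaxE mux0 muxE.
have h1 := ler_pM kx0 X0 kx hx; have h2 := ler_pM ky0 Y0 ky Y_le.
apply: le_trans (lerD h1 h2) _; apply: le_trans epsE.
have -> : E ^+ 3 * E ^- 24 = E ^- 21 by field; rewrite gt_eqF.
have -> : E ^+ 3 * (9 * E ^- 18) = 9 * E ^- 15 by field; rewrite gt_eqF.
have m1 : E ^- 21 <= E ^- 15 by exact: ler_powV.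
have m2 : E ^- 11 <= E ^- 1 by exact: ler_powV.
rewrite expr1 in m2.
(* The sum is at most 10 E^-15, and 16 E^-15 <= E^-11 <= E^-1 <= eps. *)
move: m1 m2 (half 14) (half 13) (half 12) (half 11) (pow0 11) (pow0 15).
by move: E^-1 => e1; lra_pow.
Qed.

Let Rx := norm2 (x0 - xs).
Let Ry := norm2 (y0 - ys).
Let lambda := log_factor c eps Rx Ry.

Let F_bounds : [/\ 1 <= lambda, 2 <= expR lambda, (expR lambda)^-1 <= eps,
  [/\ (expR lambda)^-1 <= mux c, Lx c <= expR lambda, (expR lambda)^-1 <= muy c
    & Ly c <= expR lambda]
  & lmax c <= expR lambda /\ (expR lambda)^-1 <= lmin c].
Proof.
apply: log_bounds => //; rewrite /lambda /log_factor.
have : 0 <= ln (1 + Rx) by rewrite ln_ge0// lerDl norm2_ge0.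
have : 0 <= ln (1 + Ry) by rewrite ln_ge0// lerDl norm2_ge0.
by lra.
Qed.

Let R_bounds : Rx <= expR lambda /\ Ry <= expR lambda.
Proof.
have Rx0 : 0 <= Rx := norm2_ge0 _; have Ry0 : 0 <= Ry := norm2_ge0 _.
have lx : 0 <= ln (1 + Rx) by rewrite ln_ge0// lerDl.
have ly : 0 <= ln (1 + Ry) by rewrite ln_ge0// lerDl.
have := normr_ge0 (ln eps); have := normr_ge0 (ln (mux c)).
have := normr_ge0 (ln (muy c)); have := normr_ge0 (ln (Lx c)).
have := normr_ge0 (ln (Ly c)); have := normr_ge0 (ln (lmax c)).
have := normr_ge0 (ln (lmin c)) => *.
have h1 : 1 + Rx <= expR lambda.
  by apply: ln_le_expR; [rewrite ltr_pwDl|rewrite /lambda /log_factor; lra].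
have h2 : 1 + Ry <= expR lambda.
  by apply: ln_le_expR; [rewrite ltr_pwDl|rewrite /lambda /log_factor; lra].
by split; lra.
Qed.

(** The logarithm of the distance bound costs 17 [lambda], all other terms together one. *)
Let T_le : T <= 18 * lambda.
Proof.
have [l1 F2 _ [muxF LxF muyF _] [lmaxF _]] := F_bounds.
have [RxF RyF] := R_bounds.
have F0 := expR_gt0 lambda.
have RxF' : dot (x0 - xs) (x0 - xs) <= expR lambda ^+ 2.
  by rewrite -norm2_le_sqr// ltW.
have RyF' : dot (ys - y0) (ys - y0) <= expR lambda ^+ 2.
  by rewrite -norm2_le_sqr ?(ltW F0)// norm2_distC.
have h := distance_bound_le mux0 muy0 lmax0 muxL lipr sch liph A_ub ys_best
  xs_stationary y1_min F2 muxF LxF muyF lmaxF RxF' RyF'.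
have {}h : ln (1 + D) <= 17 * lambda.
  rewrite -[leRHS]expRK expRM_natl ler_ln ?posrE ?exprn_gt0//.
  by rewrite ltr_pwDl.
have : 0 <= ln (1 + Rx) by rewrite ln_ge0// lerDl norm2_ge0.
have : 0 <= ln (1 + Ry) by rewrite ln_ge0// lerDl norm2_ge0.
by move: h; rewrite /T /lambda /log_size /log_factor; lra.
Qed.

Let kr := Lx c / mux c.
Let kA := Ly c * lmax c / (muy c * lmin c).

Let kr1 : 1 <= kr. Proof. by rewrite ler_pdivlMr// mul1r. Qed.
Let kA1 : 1 <= kA.
Proof. by rewrite ler_pdivlMr ?mulr_gt0// mul1r; apply: ler_pM => //; exact: ltW. Qed.
Let sr1 : 1 <= Num.sqrt kr. Proof. by rewrite -sqrtr1 ler_wsqrtr. Qed.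
Let sA1 : 1 <= Num.sqrt kA. Proof. by rewrite -sqrtr1 ler_wsqrtr. Qed.

Lemma outer_rounds_le : Nout.+1%:R <= 4322 * Num.sqrt kr * lambda.
Proof.
have [l1 _ _ _ _] := F_bounds; have [a0 _] := andP outer_alpha_itv.
(* The inverse is the root of 8 kr. With T <= 18 lambda this gives 80 * 3 * 18 = 4320; rounding up
   and the initial gradient call add one each. *)
have b : (outer_alpha c)^-1 <= 3 * Num.sqrt kr.
  have -> : 3 = Num.sqrt (3 ^+ 2) :> R by rewrite sqrtr_sqr ger0_norm.
  rewrite -sqrtrM ?sqr_ge0// /outer_alpha -sqrtrV; last by apply/ltW/divr_gt0.
  apply: ler_wsqrtr; have -> : (mux c / 2 / outer_K c)^-1 = 8 * kr.
    by rewrite /outer_K /kr; field; rewrite !gt_eqF.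
  by rewrite -natrX; move: kr1; lra.
have T0 : 0 <= T by apply: le_trans T1.
have := rounds_le 80 T0 (mulr_ge0 (ler0n R 3) (sqrtr_ge0 kr)) a0 b.
rewrite -/Nout -[Nout.+1]addn1 natrD => h.
have h1 : 80%:R * T * (3 * Num.sqrt kr) <= 240 * (18 * lambda * Num.sqrt kr).
  have : T * Num.sqrt kr <= 18 * lambda * Num.sqrt kr by rewrite ler_wpM2r// sqrtr_ge0.
  lra.
have h2 : 1 <= Num.sqrt kr * lambda by rewrite mulr_ege1.
by move: h h1 h2; rewrite -[4322 * _ * _]mulrA [18 * _ * _]mulrAC -[18 * _ * _]mulrA; lra.
Qed.

Lemma inner_rounds_le : Nin.+2%:R <= 2163 * Num.sqrt kA * lambda.
Proof.
have [l1 _ _ _ _] := F_bounds; have [a0 _] := andP inner_alpha_itv.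
(* Here 60 * 2 * 18 = 2160, plus one for rounding up and two for the extra calls. *)
have b : (inner_alpha c)^-1 <= 2 * Num.sqrt kA.
  have -> : 2 = Num.sqrt (2 ^+ 2) :> R by rewrite sqrtr_sqr ger0_norm.
  have K0 : 0 < inner_K c by exact: lt_le_trans inner_nu_le.
  rewrite -sqrtrM ?sqr_ge0// /inner_alpha -sqrtrV; last by apply/ltW/divr_gt0.
  apply: ler_wsqrtr; have -> : 2 ^+ 2 = 4 :> R by rewrite -natrX.
  by rewrite invf_div; exact (inner_condition muy0 muyL lmin0 lminmax outer_K0).
have T0 : 0 <= T by apply: le_trans T1.
have := rounds_le 60 T0 (mulr_ge0 (ler0n R 2) (sqrtr_ge0 kA)) a0 b.
rewrite -/Nin -[Nin.+2]addn2 natrD => h.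
have h1 : 60%:R * T * (2 * Num.sqrt kA) <= 120 * (18 * lambda * Num.sqrt kA).
  have : T * Num.sqrt kA <= 18 * lambda * Num.sqrt kA by rewrite ler_wpM2r// sqrtr_ge0.
  lra.
have h2 : 1 <= Num.sqrt kA * lambda by rewrite mulr_ege1.
by move: h h1 h2; rewrite -[2163 * _ * _]mulrA [18 * _ * _]mulrAC -[18 * _ * _]mulrA; lra.
Qed.

(** Each loop contributes one logarithm: gradient calls carry the first power, the other calls the
    second. The constants are variables with equations, which keeps the numerals out of the
    algebra. *)
Lemma saddle_method_cost (C1 C2 : R) : C1 = 4322 -> C2 = 2163 ->
  let res := run p prox (saddle_method c eps x0 y0) in
  Otilde (C1 * C2) c eps Rx Ry (Num.sqrt kr) (num_grad res) /\
  forall N : nat, N \in [:: num_AT res; num_A res; num_prox res] ->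
    Otilde (C1 * C2) c eps Rx Ry ((num_grad res)%:R * Num.sqrt kA) N /\
    Otilde (C1 * C2) c eps Rx Ry (Num.sqrt (kr * kA)) N.
Proof.
move=> C1E C2E res; rewrite /res run_saddle_method -/y1 -/G -/D -/T -/Nin -/Nout {res}.
simpl num_grad; simpl num_AT; simpl num_A; simpl num_prox.
have [l1 _ _ _ _] := F_bounds.
have hout := outer_rounds_le; have hin := inner_rounds_le.
rewrite -C1E in hout; rewrite -C2E in hin.
have C1_ge1 : 1 <= C1 by rewrite C1E ler1n.
have C2_ge1 : 1 <= C2 by rewrite C2E ler1n.
have C1_ge0 : 0 <= C1 by exact: le_trans C1_ge1.
have C2_ge0 : 0 <= C2 by exact: le_trans C2_ge1.
have sr0 := sqrtr_ge0 kr; have sA0 := sqrtr_ge0 kA.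
have kr0 : 0 <= kr by exact: le_trans kr1.
rewrite /Otilde -/lambda (sqrtrM kA kr0); move: l1 hout hin sr0 sA0.
move: lambda (Num.sqrt kr) (Num.sqrt kA) Nout Nin => l a b no ni l1 hout hin a0 b0.
have l0 : 0 <= l by exact: le_trans l1.
have ll : l <= l ^+ 2 by rewrite expr2 ler_peMl.
have C1_le : C1 <= C1 * C2 by rewrite ler_peMr.
split.
  apply: le_trans hout _; apply: ler_pM; rewrite ?mulr_ge0//.
  exact: ler_wpM2r.
move=> N; rewrite !inE orbb orbb => /eqP ->.
have NN : (no * ni).+2%:R <= no.+1%:R * ni.+2%:R :> R.
  by rewrite -natrM ler_nat loop_count_le.
have prod_le : no.+1%:R * ni.+2%:R <= no.+1%:R * (C2 * b * l).
  by apply: ler_wpM2l.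
split.
  apply: le_trans NN _; apply: le_trans prod_le _.
  have -> : C1 * C2 * (no.+1%:R * b) * l ^+ 2 = no.+1%:R * (C1 * (C2 * b * l ^+ 2)).
    by ring.
  apply: ler_wpM2l => //; apply: (@le_trans _ _ (C2 * b * l ^+ 2)).
    by apply: ler_wpM2l => //; exact: mulr_ge0.
  by rewrite ler_peMl// mulr_ge0 ?mulr_ge0// sqr_ge0.
apply: le_trans NN _.
have -> : C1 * C2 * (a * b) * l ^+ 2 = (C1 * a * l) * (C2 * b * l) by ring.
by apply: ler_pM.
Qed.

End Main.

Theorem mainTheorem3 (R : realType) :
  exists (C : R)
    (M : forall n m : nat,
       constants R -> R -> 'cV[R]_n -> 'cV[R]_m -> method R n m),
  0 < C /\
  forall (n m : nat) (c : constants R) (eps : R)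
    (x0 : 'cV[R]_n) (y0 : 'cV[R]_m) (p : saddle_problem R n m)
    (prox : 'cV[R]_m -> {posnum R} -> 'cV[R]_m)
    (xs : 'cV[R]_n) (ys : 'cV[R]_m),
  0 < eps ->
  in_class c p ->
  prox_solver (ph p) prox ->
  minimizer (primal p) xs ->
  best_response p xs ys ->
  let Rx := norm2 (x0 - xs) in
  let Ry := norm2 (y0 - ys) in
  let res := run p prox (M n m c eps x0 y0) in
  let kr := Lx c / mux c in
  let kA := Ly c * lmax c / (muy c * lmin c) in
  [/\ eps_solution p eps x0 y0 Rx Ry xs (out_x res) (out_y res),
      Otilde C c eps Rx Ry (Num.sqrt kr) (num_grad res) &
      forall N : nat, N \in [:: num_AT res; num_A res; num_prox res] ->
        Otilde C c eps Rx Ry ((num_grad res)%:R * Num.sqrt kA) N /\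
        Otilde C c eps Rx Ry (Num.sqrt (kr * kA)) N].
Proof.
have [C1 C1E] : exists C1 : R, C1 = 4322 by exists 4322.
have [C2 C2E] : exists C2 : R, C2 = 2163 by exists 2163.
exists (C1 * C2), (fun n m => @saddle_method R n m).
split; first by apply: mulr_gt0; rewrite ?C1E ?C2E ltr0n.
move=> n m c eps x0 y0 p prox xs ys eps0 cls prox_ok xs_min ys_best.
have [grad_cost other_cost] :=
  saddle_method_cost x0 y0 eps0 cls prox_ok xs_min ys_best C1E C2E.
by split=> //; exact: saddle_method_correct.
Qed.
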